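(* Let $p=p_n$ be a sequence of positive integers. Assume that for each $n$ the rows of $X_n\in\mathbb R^{n\times p}$ are i.i.d. $N(0,\tilde\Sigma_n)$, where $$c_m\le\inf_{n\ge1}\lambda_{\min}(\tilde\Sigma_n)\le\sup_{n\ge1}\lambda_{\max}(\tilde\Sigma_n)\le c_M$$ for constants $0<c_m\le c_M<\infty$. Let $S_n=\frac1nX_n^\top X_n$ and $b\in\operatorname{range}(X_n^\top)$, let $L_n=\lambda_{\max}(S_n)$ and let $\mu_n$ be the smallest nonzero eigenvalue of $S_n$. Fix $\varepsilon\in(0,1)$ and define the worst-case iteration complexity of gradient descent with step size $\eta=1/L_n$ by $$T_{\varepsilon,n}^{\mathrm{wc}}=\sup_{\theta^{(0)}\ne\theta_n^\star}T_{\varepsilon,n}.$$ Then $$T_{\varepsilon,n}^{\mathrm{wc}}\ge\left\lceil\frac{L_n-\mu_n}{2\mu_n}\log\Big(\frac1\varepsilon\Big)\right\rceil.$$ Finally, if $p/n\to1$ as $n\to\infty$, then for every fixed $\varepsilon\in(0,1)$, $\mathbb E[T_{\varepsilon,n}^{\mathrm{wc}}]\to\infty$ as $n\to\infty$.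
   Context: $\lambda_{\min},\lambda_{\max}$ are the smallest and largest eigenvalues of a symmetric matrix; $\operatorname{range}(A)$ is the column space of $A$. Under the stated assumptions $X_n$ has rank $\min(n,p)$ almost surely, so $\mu_n$ is well defined almost surely. Let $g_n(\theta)=\frac12\theta^\top S_n\theta-b^\top\theta$ for $\theta\in\mathbb R^p$; gradient descent with step size $\eta$ started at $\theta^{(0)}\in\mathbb R^p$ is $\theta^{(t+1)}=\theta^{(t)}-\eta\nabla g_n(\theta^{(t)})=\theta^{(t)}-\eta(S_n\theta^{(t)}-b)$. Set $\theta_n^\star=S_n^{-1}b$ if $p\le n$ and $\theta_n^\star=S_n^+b$ (Moore--Penrose pseudo-inverse) if $p>n$. The iteration complexity (for a given start $\theta^{(0)}$) is $$T_{\varepsilon,n}=\inf\{t\in\{0,1,2,\dots\}: g_n(\theta^{(t)})-g_n(\theta_n^\star)\le\varepsilon(g_n(\theta^{(0)})-g_n(\theta_n^\star))\}.$$ *)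

(* Defs.v *)
From HB Require Import structures.
From mathcomp Require Import all_boot all_order all_algebra.
From mathcomp Require Import all_classical all_reals all_analysis.

Set Implicit Arguments.
Unset Strict Implicit.
Unset Printing Implicit Defensive.

Import Order.TTheory GRing.Theory Num.Theory.
Import numFieldNormedType.Exports.

Local Open Scope classical_set_scope.
Local Open Scope ring_scope.

(* Real eigenvalues. The set of eigenvalues is finite, so [sup] and [inf] below
   are a maximum and a minimum whenever that set is nonempty, which holds for a
   symmetric matrix of positive size; for [mu_min] the matrix must moreover be
   nonzero. *)
Section Eigenvalues.
Variables (R : realType) (p : nat).
Implicit Types A : 'M[R]_p.

Definition lambda_max A : R := sup [set a | eigenvalue A a].

Definition lambda_min A : R := inf [set a | eigenvalue A a].

Definition mu_min A : R := inf [set a | eigenvalue A a /\ a != 0].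

End Eigenvalues.

Section Matrices.
Variable R : realType.

Definition column_space m n (A : 'M[R]_(m, n)) : set 'cV[R]_m :=
  range (fun z : 'cV[R]_n => A *m z).

Definition is_pinv m n (A : 'M[R]_(m, n)) (B : 'M[R]_(n, m)) : Prop :=
  [/\ A *m B *m A = A, B *m A *m B = B,
      (A *m B)^T = A *m B & (B *m A)^T = B *m A].

(* Moore-Penrose pseudo-inverse; existence and uniqueness are [pinvP] and
   [is_pinv_uniq]. *)
Definition pinv m n (A : 'M[R]_(m, n)) : 'M[R]_(n, m) :=
  xget 0 [set B | is_pinv A B].

Lemma is_pinv_uniq m n (A : 'M[R]_(m, n)) (B C : 'M[R]_(n, m)) :
  is_pinv A B -> is_pinv A C -> B = C.
Proof.
move=> [b1 b2 b3 b4] [c1 c2 c3 c4].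
have AB : A *m B = A *m C.
  rewrite -b3 -{1}c1 -(mulmxA (A *m C)) trmx_mul b3 c3 mulmxA.
  by rewrite b1.
have BA : B *m A = C *m A.
  rewrite -b4 -{1}c1 -mulmxA mulmxA trmx_mul c4 b4.
  by rewrite -mulmxA (mulmxA A) b1.
by rewrite -b2 -mulmxA AB mulmxA BA c2.
Qed.

Lemma row_free_gram_unit m n (A : 'M[R]_(m, n)) :
  row_free A -> A *m A^T \in unitmx.
Proof.
move=> fA; rewrite -row_free_unit -kermx_eq0 -submx0; apply/row_subP => i.
set u := row i _.
have uA0 : u *m (A *m A^T) = 0 by apply/sub_kermxP; rewrite row_sub.
suff vE : u *m A = 0 by rewrite submx0; apply/eqP/(row_free_inj fA); rewrite mul0mx.
have /matrixP/(_ 0 0) : (u *m A) *m (u *m A)^T = 0.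
  by rewrite trmx_mul mulmxA -(mulmxA u) uA0 mul0mx.
rewrite !mxE => /eqP; rewrite psumr_eq0 => [/allP h|j _].
  apply/matrixP => a j; rewrite ord1 [RHS]mxE; apply/eqP.
  by have := h j (mem_index_enum _); rewrite [X in _ * X]mxE mulf_eq0 orbb.
by rewrite [X in _ * X]mxE -expr2 sqr_ge0.
Qed.

Lemma is_pinv_mulmx m r n (C : 'M[R]_(m, r)) (F : 'M[R]_(r, n)) :
  row_full C -> row_free F ->
  is_pinv (C *m F) (F^T *m invmx (F *m F^T) *m invmx (C^T *m C) *m C^T).
Proof.
move=> fC fF; set B := (X in is_pinv _ X).
have uF : F *m F^T \in unitmx by exact: row_free_gram_unit.
have uC : C^T *m C \in unitmx.
  rewrite -{2}[C]trmxK; apply: row_free_gram_unit.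
  by rewrite /row_free mxrank_tr.
have symC : (invmx (C^T *m C))^T = invmx (C^T *m C).
  by rewrite trmx_inv trmx_mul trmxK.
have symF : (invmx (F *m F^T))^T = invmx (F *m F^T).
  by rewrite trmx_inv trmx_mul trmxK.
have AB : C *m F *m B = C *m invmx (C^T *m C) *m C^T.
  by rewrite /B !mulmxA -(mulmxA C F) mulmxK.
have BA : B *m (C *m F) = F^T *m invmx (F *m F^T) *m F.
  by rewrite /B !mulmxA -(mulmxA _ C^T C) mulmxKV.
split.
- by rewrite AB !mulmxA -(mulmxA _ C^T C) mulmxKV.
- by rewrite BA /B !mulmxA -(mulmxA _ F F^T) mulmxKV.
- by rewrite AB !trmx_mul trmxK symC mulmxA.
- by rewrite BA !trmx_mul trmxK symF mulmxA.
Qed.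

Lemma pinvP m n (A : 'M[R]_(m, n)) : is_pinv A (pinv A).
Proof.
rewrite /pinv; case: xgetP => [B -> //|h]; exfalso.
have := is_pinv_mulmx (col_base_full A) (row_base_free A).
by rewrite mulmx_base; exact: h.
Qed.

End Matrices.

Section GradientDescent.
Variables (R : realType) (p : nat).
Implicit Types (S : 'M[R]_p) (b theta : 'cV[R]_p) (eta : R).

Definition quad_loss S b theta : R :=
  2^-1 * (theta^T *m S *m theta) 0 0 - (b^T *m theta) 0 0.

Definition gd_step S b eta theta : 'cV[R]_p := theta - eta *: (S *m theta - b).

Definition gd S b eta theta0 (t : nat) : 'cV[R]_p :=
  iter t (gd_step S b eta) theta0.

(* Number of gradient descent steps needed to reach relative accuracy [eps]
   towards [thetastar]; it is [+oo] if this accuracy is never reached. *)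
Definition iter_complexity S b eta thetastar (eps : R) theta0 : \bar R :=
  ereal_inf [set (t%:R : R)%:E | t in [set t : nat |
    quad_loss S b (gd S b eta theta0 t) - quad_loss S b thetastar <=
    eps * (quad_loss S b theta0 - quad_loss S b thetastar)]].

End GradientDescent.

Section LeastSquares.
Variables (R : realType) (n p : nat).
Implicit Types (X : 'M[R]_(n, p)) (b : 'cV[R]_p).

Definition gram X : 'M[R]_p := n%:R^-1 *: (X^T *m X).

Definition theta_star X b : 'cV[R]_p :=
  if (p <= n)%N then invmx (gram X) *m b else pinv (gram X) *m b.

Definition wc_complexity X b (eps : R) : \bar R :=
  ereal_sup [set iter_complexity (gram X) b (lambda_max (gram X))^-1
                   (theta_star X b) eps theta0
            | theta0 in [set theta0 | theta0 != theta_star X b]].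

End LeastSquares.

Section Gaussian.
Context d (T : measurableType d) (R : realType) (P : probability T R).

(* Law of N(0, v). The library's [normal_prob] is parametrized by the standard
   deviation and is not degenerate when the latter is 0, whence the first case. *)
Definition centered_normal (v : R) (B : set R) : \bar R :=
  if v == 0 then \d_(0 : R) B else normal_prob 0 (Num.sqrt v) B.

(* [Y] has law N(0, Sigma): every linear combination of the coordinates of [Y]
   is a univariate centered normal variable with the matching variance. *)
Definition gaussian_vector p (Y : T -> 'rV[R]_p) (Sigma : 'M[R]_p) : Prop :=
  forall (u : 'cV[R]_p) (B : set R), measurable B ->
    P [set w | B ((Y w *m u) 0 0)] = centered_normal ((u^T *m Sigma *m u) 0 0) B.

Definition mutually_independent (I : finType) (F : I -> set (set T)) : Prop :=
  forall (J : {set I}) (E : I -> set T), (forall i, i \in J -> F i (E i)) ->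
    P (\big[setI/setT]_(i in J) E i) = (\prod_(i in J) P (E i))%E.

(* [g_sigma_preimage] gives the sigma-algebra generated by the coordinates of
   row [i]. *)
Definition iid_gaussian_rows n p (X : T -> 'M[R]_(n, p)) (Sigma : 'M[R]_p) :
    Prop :=
  [/\ forall i j, measurable_fun setT (fun w => X w i j),
      forall i, gaussian_vector (fun w => row i (X w)) Sigma
    & mutually_independent
        (fun i : 'I_n => g_sigma_preimage (fun (j : 'I_p) w => X w i j))].

End Gaussian.

(* Main.v *)
Require Import Defs.
From HB Require Import structures.
From mathcomp Require Import all_boot all_order all_algebra.
From mathcomp Require Import all_classical all_reals all_analysis.
From mathcomp Require Import measurable_realfun ring lra.

Import Order.TTheory GRing.Theory Num.Theory.
Import numFieldNormedType.Exports.

Local Open Scope classical_set_scope.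
Local Open Scope ring_scope.

Set Implicit Arguments.
Unset Strict Implicit.
Unset Printing Implicit Defensive.

(** The lower bound holds for every sample. Since [b] lies in the range of the
    transpose of [X], some [theta] satisfies [gram X *m theta = b]. Started at
    [theta + s *: w], with [w] an eigenvector for the smallest nonzero eigenvalue
    [mu], gradient descent stays on this line and its excess loss over the minimum
    is multiplied by [(1 - mu / L) ^+ 2] at each step. As [s] grows, the gap between
    the loss at the reference point and the minimum becomes negligible, hence at
    least [t] steps are needed as soon as [eps < (1 - mu / L) ^+ (2 * (t - 1))].
    The inequality [1 / (1 - mu / L) = 1 + mu / (L - mu) <= expR (mu / (L - mu))]
    turns this into the stated bound, [wc_complexity_lower].

    For the divergence it remains to see that, when [p / n] tends to 1, the ratio
    [L / mu] exceeds any constant with probability at least one half for large [n]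
    ([ill_conditioned_event]). Let [m = minn n p - 1], and let [Q] be the orthogonal
    projector onto the complement of the span of the first [m] rows. Almost surely
    the trace of [Q] is [p - m] and the residual of the row of index [m] is not zero.
    This residual lies in the row space of [X] and is orthogonal to the first [m]
    rows; used as a test vector in the variational characterization of [mu], it
    gives
      [n * mu <= \sum_(i >= m) (squared norm of the residual of row i)]
    ([mu_min_residual_bound]). The row [i >= m] is independent of [Q], so its squared
    residual has expectation at most a constant times [c_M * \tr Q], by integrating
    out the row with [Q] frozen ([residual_second_moment]). In total [n * mu] has
    expectation of order at most [(n - m) * (p - m) = |n - p| + 1], which is
    negligible with respect to [n]. On the other hand [L] is at least the mean square
    of the first column of [X], and Gaussian variables of variance at least [c_m] are
    rarely small. Markov's inequality applied to these two expectations yields the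
    event. *)

(** * Inner products and Rayleigh quotients *)

Section InnerProduct.
Context {R : realType} {p : nat}.
Implicit Types (u v w : 'rV[R]_p) (S : 'M[R]_p).

Definition dot u v : R := (u *m v^T) 0 0.

Lemma dotE u v : dot u v = \sum_i u 0 i * v 0 i.
Proof. by rewrite /dot mxE; apply: eq_bigr => i _; rewrite mxE. Qed.

Lemma dotC u v : dot u v = dot v u.
Proof. by rewrite !dotE; apply: eq_bigr => i _; rewrite mulrC. Qed.

Lemma dotDl u v w : dot (u + v) w = dot u w + dot v w.
Proof. by rewrite /dot mulmxDl mxE. Qed.

Lemma dotDr u v w : dot w (u + v) = dot w u + dot w v.
Proof. by rewrite dotC dotDl !(dotC w). Qed.

Lemma dotZl a u w : dot (a *: u) w = a * dot u w.
Proof. by rewrite /dot -scalemxAl mxE. Qed.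

Lemma dotZr a u w : dot w (a *: u) = a * dot w u.
Proof. by rewrite dotC dotZl dotC. Qed.

Lemma dotNl u w : dot (- u) w = - dot u w.
Proof. by rewrite -scaleN1r dotZl mulN1r. Qed.

Lemma dotBl u v w : dot (u - v) w = dot u w - dot v w.
Proof. by rewrite dotDl dotNl. Qed.

Lemma dotBr u v w : dot w (u - v) = dot w u - dot w v.
Proof. by rewrite dotC dotBl !(dotC w). Qed.

Lemma dot0l u : dot 0 u = 0.
Proof. by rewrite /dot mul0mx mxE. Qed.

Lemma dotv_ge0 u : 0 <= dot u u.
Proof. by rewrite dotE sumr_ge0 // => i _; rewrite -expr2 sqr_ge0. Qed.

Lemma sqr_coord_le_dot u i : u 0 i ^+ 2 <= dot u u.
Proof.
rewrite dotE (bigD1 i) //= -expr2 lerDl sumr_ge0 // => j _.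
by rewrite -expr2 sqr_ge0.
Qed.

Lemma dotv_eq0 u : (dot u u == 0) = (u == 0).
Proof.
apply/eqP/eqP => [u0|->]; last by rewrite dot0l.
apply/rowP => i; rewrite mxE; apply/eqP; rewrite -sqrf_eq0.
by rewrite eq_le sqr_ge0 andbT -u0 sqr_coord_le_dot.
Qed.

Lemma dotv_gt0 u : (0 < dot u u) = (u != 0).
Proof. by rewrite lt0r dotv_eq0 dotv_ge0 andbT. Qed.

Lemma dot_mulmxC S u v : S^T = S -> dot (u *m S) v = dot u (v *m S).
Proof. by move=> sS; rewrite /dot trmx_mul sS mulmxA. Qed.

(** The discriminant argument applied to the norm of [u] minus its projection on
    the line of [v]. *)
Lemma cauchy_schwarz u v : dot u v ^+ 2 <= dot u u * dot v v.
Proof.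
have [->|v0] := eqVneq v 0; first by rewrite dotC !dot0l expr0n mulr0.
have vv : 0 < dot v v by rewrite dotv_gt0.
have := dotv_ge0 (dot v v *: u - dot u v *: v).
rewrite !(dotBl, dotBr, dotZl, dotZr) (dotC v u).
rewrite (_ : _ - _ = dot v v * (dot u u * dot v v - dot u v ^+ 2)); last by ring.
by rewrite pmulr_rge0 // subr_ge0.
Qed.

Lemma quadratic_continuous S : continuous (fun u => dot (u *m S) u).
Proof.
rewrite (_ : (fun u => _) = fun u => \sum_j (\sum_i u 0 i * S i j) * u 0 j); last first.
  by apply/funext => u; rewrite dotE; apply: eq_bigr => j _; rewrite mxE.
apply: continuous_big => [|j _]; first exact: add_continuous.
move=> u; apply: continuousM; last exact: coord_continuous.
apply: continuous_big => [|i _]; first exact: add_continuous.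
move=> w; apply: continuousM; first exact: coord_continuous.
exact: cst_continuous.
Qed.

End InnerProduct.

Lemma dot_mulmx_tr {R : realType} m p (A : 'M[R]_(m, p)) (u : 'rV_m) (v : 'rV_p) :
  dot (u *m A) v = dot u (v *m A^T).
Proof. by rewrite /dot trmx_mul trmxK mulmxA. Qed.

Section Rayleigh.
Context {R : realType} {p : nat}.
Implicit Types (u v w : 'rV[R]_p) (S : 'M[R]_p).

(** The form has a minimum at [v], and [dot (v *m S) h] is half of its derivative
    there in the direction [h]. *)
Lemma nonneg_form_critical m (U : 'M[R]_(m, p)) S v h : S^T = S ->
  (forall u, (u <= U)%MS -> 0 <= dot (u *m S) u) ->
  (v <= U)%MS -> (h <= U)%MS -> dot (v *m S) v = 0 -> dot (v *m S) h = 0.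
Proof.
move=> sS S_ge0 vU hU v0; set b := dot (v *m S) h; set c := dot (h *m S) h.
have c0 : 0 <= c := S_ge0 _ hU.
have c1 : c + 1 != 0 by rewrite gt_eqF // ltr_wpDl.
pose t := - b / (c + 1).
have : 0 <= dot ((v + t *: h) *m S) (v + t *: h).
  by apply: S_ge0; rewrite addmx_sub // scalemx_sub.
rewrite mulmxDl -scalemxAl !(dotDl, dotDr, dotZl, dotZr) v0.
rewrite (dot_mulmxC h v sS) (dotC h) -/b -/c add0r.
rewrite (_ : _ + _ = - (b ^+ 2 * ((c + 2) / (c + 1) ^+ 2))); last by rewrite /t; field.
rewrite oppr_ge0 pmulr_lle0; last by rewrite divr_gt0 ?exprn_gt0 //; lra.
by move=> b0; apply/eqP; rewrite -sqrf_eq0 eq_le b0 sqr_ge0.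
Qed.

Lemma compact_unit_sphere_sub m (U : 'M[R]_(m, p)) :
  compact [set v : 'rV[R]_p | (v <= U)%MS /\ dot v v = 1].
Proof.
apply: bounded_closed_compact.
  exists 1; split => // M M1 v [_ v1]; rewrite /Num.norm /= mx_normrE.
  apply: bigmax_le => [|[i j] _ /=]; first lra.
  rewrite ord1 (le_trans _ (ltW M1)) // -(@ler_pXn2r _ 2) ?nnegrE //.
  by rewrite expr1n -normrX ger0_norm ?sqr_ge0 // -v1 sqr_coord_le_dot.
pose C := cokermx U *m (cokermx U)^T.
have -> : [set v : 'rV[R]_p | (v <= U)%MS /\ dot v v = 1] =
    (fun v => dot (v *m C) v) @^-1` [set 0] `&`
    (fun v => dot (v *m 1%:M) v) @^-1` [set 1].
  apply/seteqP; split => v /=; rewrite mulmx1 submxE /C; move: (cokermx U) => K;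
    rewrite mulmxA dot_mulmx_tr trmxK.
    by move=> [/eqP -> ->]; rewrite dot0l.
  by move=> [/eqP + ->]; rewrite dotv_eq0.
apply: closedI; apply: preimage_closed => [v _|];
  try exact: quadratic_continuous; exact: closed_eq.
Qed.

(** A minimum of the Rayleigh quotient over an invariant subspace exists by
    compactness of the sphere, and a minimizer is an eigenvector because
    [S - a] is then a nonnegative form on that subspace vanishing there. *)
Lemma rayleigh_min m (U : 'M[R]_(m, p)) S : S^T = S -> stablemx U S -> U != 0 ->
  exists a v, [/\ v != 0, (v <= U)%MS, v *m S = a *: v &
    forall u, (u <= U)%MS -> a * dot u u <= dot (u *m S) u].
Proof.
move=> sS stab U0; pose A := [set v : 'rV[R]_p | (v <= U)%MS /\ dot v v = 1].
have unitA u : (u <= U)%MS -> u != 0 -> A ((Num.sqrt (dot u u))^-1 *: u).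
  move=> uU u0; split; first by rewrite scalemx_sub.
  rewrite dotZl dotZr mulrA -expr2 exprVn sqr_sqrtr ?dotv_ge0 // mulVf //.
  by rewrite dotv_eq0.
have A0 : A !=set0.
  have /rowV0Pn[u uU u0] := U0; by eexists; exact: unitA uU u0.
have [|v] := EVT_min_rV A0 (@compact_unit_sphere_sub m U) (f := fun u => dot (u *m S) u).
  exact/continuous_subspaceT/quadratic_continuous.
rewrite inE => -[vU v1] vmin; set a := dot (v *m S) v.
have a_min u : (u <= U)%MS -> a * dot u u <= dot (u *m S) u.
  move=> uU; have [->|u0] := eqVneq u 0; first by rewrite mul0mx !dot0l mulr0.
  have := vmin _ (mem_set (unitA _ uU u0)).
  rewrite -scalemxAl dotZl dotZr mulrA -expr2 exprVn sqr_sqrtr ?dotv_ge0 //.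
  by rewrite ler_pdivlMl ?dotv_gt0 // mulrC.
have vN0 : v != 0 by rewrite -dotv_eq0 v1 oner_eq0.
exists a, v; split=> //; pose M := S - a%:M.
have ME u : u *m M = u *m S - a *: u by rewrite mulmxBr mul_mx_scalar.
have vMU : (v *m M <= U)%MS.
  rewrite ME addmx_sub ?eqmx_opp ?scalemx_sub //.
  exact: submx_trans (submxMr _ vU) stab.
suff : dot (v *m M) (v *m M) == 0 by rewrite dotv_eq0 ME subr_eq0 => /eqP.
apply/eqP; apply: (@nonneg_form_critical m U M v) => //.
- by rewrite /M linearB /= sS tr_scalar_mx.
- by move=> u /a_min; rewrite ME dotBl dotZl subr_ge0.
- by rewrite ME dotBl dotZl v1 mulr1 subrr.
Qed.

End Rayleigh.

(** * Extreme eigenvalues *)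

Section ExtremeEigenvalues.
Context {R : realType} {p : nat}.
Implicit Types (u v w : 'rV[R]_p) (S : 'M[R]_p).

Lemma lambda_min_form S u : S^T = S ->
  lambda_min S * dot u u <= dot (u *m S) u.
Proof.
move=> sS; have [->|u0] := eqVneq u 0; first by rewrite mul0mx !dot0l mulr0.
have U0 : (1%:M : 'M[R]_p) != 0.
  by apply: contraNneq u0 => I0; rewrite -(mulmx1 u) I0 mulmx0.
have [|a [v [v0 _ va a_min]]] := rayleigh_min sS _ U0; first exact: submx1.
apply: le_trans (a_min _ (submx1 _)).
rewrite ler_wpM2r ?dotv_ge0 // ge_inf //.
  exists a => c /= /eigenvalueP[w wc w0].
  have := a_min w (submx1 _); rewrite wc dotZl ler_pM2r //.
  by rewrite dotv_gt0.
by apply/eigenvalueP; exists v.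
Qed.

Lemma lambda_max_form S u : S^T = S ->
  dot (u *m S) u <= lambda_max S * dot u u.
Proof.
move=> sS; have [->|u0] := eqVneq u 0; first by rewrite mul0mx !dot0l mulr0.
have U0 : (1%:M : 'M[R]_p) != 0.
  by apply: contraNneq u0 => I0; rewrite -(mulmx1 u) I0 mulmx0.
have sNS : (- S)^T = - S by rewrite linearN /= sS.
have [|a [v [v0 _ va a_min]]] := rayleigh_min sNS _ U0; first exact: submx1.
have a_max w : dot (w *m S) w <= - a * dot w w.
  by have := a_min w (submx1 _); rewrite mulmxN dotNl mulNr lerNr.
apply: le_trans (a_max u) _.
rewrite ler_wpM2r ?dotv_ge0 // ub_le_sup //.
  exists (- a) => c /= /eigenvalueP[w wc w0].
  by have := a_max w; rewrite wc dotZl ler_pM2r // dotv_gt0.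
by apply/eigenvalueP; exists v => //; rewrite scaleNr -va mulmxN opprK.
Qed.

End ExtremeEigenvalues.

Section Gram.
Context {R : realType} {n p : nat}.
Implicit Types (X : 'M[R]_(n, p)) (u v : 'rV[R]_p).

Lemma gram_sym X : (gram X)^T = gram X.
Proof. by rewrite /gram linearZ /= trmx_mul trmxK. Qed.

Lemma gram_form X u :
  dot (u *m gram X) u = n%:R^-1 * dot (u *m X^T) (u *m X^T).
Proof. by rewrite /gram -scalemxAr dotZl mulmxA (dot_mulmx_tr X). Qed.

Lemma gram_form_sum X u :
  dot (u *m gram X) u = n%:R^-1 * \sum_i dot (row i X) u ^+ 2.
Proof.
rewrite gram_form dotE; congr (_ * _); apply: eq_bigr => i _.
rewrite -expr2 dotE mxE; congr (_ ^+ 2).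
by apply: eq_bigr => j _; rewrite !mxE mulrC.
Qed.

Lemma submx_gram X v : (0 < n)%N -> (v *m gram X <= X)%MS.
Proof. by move=> n0; rewrite -scalemxAr scalemx_sub // mulmxA submxMl. Qed.

(** On the row space of [X], where the eigenvectors for nonzero eigenvalues live,
    the form is positive definite, so the minimum of the Rayleigh quotient there
    is the smallest nonzero eigenvalue. *)
Lemma mu_min_spec X : (0 < n)%N -> X != 0 -> exists v,
  [/\ v != 0, v *m gram X = mu_min (gram X) *: v, 0 < mu_min (gram X) &
    forall u, (u <= X)%MS -> mu_min (gram X) * dot u u <= dot (u *m gram X) u].
Proof.
move=> n0 X0.
have stab : stablemx X (gram X).
  by rewrite /gram -scalemxAr scalemx_sub // mulmxA submxMl.
have [a [v [v0 vX va a_min]]] := rayleigh_min (gram_sym X) stab X0.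
have n1 : 0 < n%:R^-1 :> R by rewrite invr_gt0 ltr0n.
have a_gt0 : 0 < a.
  have: 0 < dot (v *m gram X) v.
    rewrite gram_form pmulr_rgt0 // dotv_gt0; apply: contra_neq v0 => vXT.
    have [z vE] := submxP vX; apply/eqP; rewrite -dotv_eq0 {2}vE.
    by rewrite dotC dot_mulmx_tr vXT dotC dot0l.
  by rewrite va dotZl pmulr_lgt0 // dotv_gt0.
have a_eig : [set c | eigenvalue (gram X) c /\ c != 0] a.
  by split; [apply/eigenvalueP; exists v|rewrite gt_eqF].
have a_lb : lbound [set c | eigenvalue (gram X) c /\ c != 0] a.
  move=> c /= [/eigenvalueP[w wc w0] c0].
  have wX : (w <= X)%MS by rewrite -(scalerK c0 w) -wc scalemx_sub // submx_gram.
  by have := a_min _ wX; rewrite wc dotZl ler_pM2r // dotv_gt0.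
have E : mu_min (gram X) = a.
  apply/eqP; rewrite eq_le; apply/andP; split; first by apply: ge_inf; first exists a.
  by apply: lb_le_inf; first by exists a.
by exists v; rewrite E.
Qed.

Lemma gram_tr0 m (A : 'M[R]_(m, p)) : A *m A^T = 0 -> A = 0.
Proof.
move=> A0; apply/row_matrixP => i; apply/eqP; rewrite row0 -dotv_eq0.
have /matrixP/(_ i i) := A0; rewrite dotE !mxE => AAi; apply/eqP.
by rewrite -[RHS]AAi; apply: eq_bigr => j _; rewrite !mxE.
Qed.

End Gram.

(** The row space of [X] is that of [X^T *m X], because [X *m K] vanishes as soon as
    its Gram matrix does. *)
Lemma column_space_gram {R : realType} n p (X : 'M[R]_(n, p)) (b : 'cV[R]_p) :
  (0 < n)%N -> column_space X^T b -> exists theta, gram X *m theta = b.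
Proof.
move=> n0 [z _ <-].
have XX : (X <= X^T *m X)%MS.
  rewrite submxE; set K := cokermx _; apply/eqP/trmx_inj; rewrite trmx0.
  apply: gram_tr0; rewrite trmxK trmx_mul -mulmxA.
  by rewrite (mulmxA X^T) /K mulmx_coker mulmx0.
have [D /(congr1 trmx) XE] := submxP XX.
exists (n%:R *: (D^T *m z)); rewrite /gram -scalemxAl -scalemxAr scalerA.
rewrite mulVf ?scale1r; last by rewrite pnatr_eq0 -lt0n.
by rewrite mulmxA; congr (_ *m z); rewrite [RHS]XE !trmx_mul trmxK.
Qed.

(** * The lower bound for gradient descent *)

Section GradientDescentLowerBound.
Context {R : realType} {p : nat}.
Implicit Types (S : 'M[R]_p) (b theta w : 'cV[R]_p).

Lemma quad_loss_shift S b theta w : S^T = S -> S *m theta = b ->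
  quad_loss S b (theta + w) = quad_loss S b theta + 2^-1 * dot (w^T *m S) w^T.
Proof.
move=> sS <-; rewrite /quad_loss /dot trmxK [(theta + w)^T]linearD /=.
rewrite !(mulmxDl, mulmxDr) trmx_mul sS ?mulmxA.
have E : w^T *m S *m theta = theta^T *m S *m w.
  rewrite [LHS]mx11_scalar -tr_scalar_mx -mx11_scalar.
  by rewrite !trmx_mul trmxK sS mulmxA.
by rewrite E !mxE; field.
Qed.

Lemma gd_eigenvector S b eta theta w a t : S *m theta = b -> S *m w = a *: w ->
  gd S b eta (theta + w) t = theta + (1 - eta * a) ^+ t *: w.
Proof.
move=> Sb Sw; elim: t => [|t IH]; first by rewrite expr0 scale1r.
rewrite /gd iterS -/(gd _ _ _ _ _) IH /gd_step mulmxDr Sb -scalemxAr Sw.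
rewrite (addrAC b) subrr add0r -addrA; congr (_ + _).
by rewrite !scalerA exprS -scalerBl; congr (_ *: _); ring.
Qed.

Lemma iter_complexity_ge S b eta thetastar eps theta0 (N : nat) :
  (forall t, (t < N)%N -> eps * (quad_loss S b theta0 - quad_loss S b thetastar) <
     quad_loss S b (gd S b eta theta0 t) - quad_loss S b thetastar) ->
  ((N%:R : R)%:E <= iter_complexity S b eta thetastar eps theta0)%E.
Proof.
move=> H; apply: le_ereal_inf_tmp => _ [t /= Ht <-]; rewrite lee_fin ler_nat.
by rewrite leqNgt; apply/negP => /H; rewrite ltNge Ht.
Qed.

End GradientDescentLowerBound.

(** With [x = mu / (L - mu)], the contraction factor is the inverse of [1 + x], hence
    at least [expR (- x)]. *)
Lemma contraction_power_gt {R : realType} (L mu eps : R) (k : nat) :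
  0 < mu -> mu < L -> 0 < eps -> k%:R < (L - mu) / (2 * mu) * ln (1 / eps) ->
  eps < ((1 - L^-1 * mu) ^+ k) ^+ 2.
Proof.
move=> mu0 muL eps0 kR; set x := mu / (L - mu).
have Lmu : 0 < L - mu by rewrite subr_gt0.
have L0 : 0 < L by apply: lt_trans muL.
have x0 : 0 < x by rewrite divr_gt0.
have -> : 1 - L^-1 * mu = (1 + x)^-1.
  rewrite /x; field; rewrite gt_eqF //= gt_eqF //=; lra.
have -> : eps = expR (ln eps) by rewrite lnK // posrE.
apply: (@lt_le_trans _ _ (expR (- x) ^+ (k * 2))).
  rewrite -expRM_natl ltr_expR natrM mulrN ltrNr -lnV ?posrE //.
  move: kR; rewrite div1r => kR.
  rewrite (_ : _ * x = k%:R * ((2 * mu) / (L - mu))); last by rewrite /x mulrA; ring.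
  rewrite -ltr_pdivlMr ?divr_gt0 ?mulr_gt0 // invf_div mulrC //.
rewrite -exprM; apply: lerXn2r; rewrite ?nnegrE ?expR_ge0 // ?invr_ge0.
  by rewrite addr_ge0 // ltW.
by rewrite expRN lef_pV2 ?posrE ?expR_gt0 ?expR_ge1Dx // addr_gt0.
Qed.

Section WorstCase.
Context {R : realType} {n p : nat}.
Implicit Types (X : 'M[R]_(n, p)) (b : 'cV[R]_p).

Lemma wc_complexity_ge0 X b (eps : R) : (0 < p)%N -> (0 <= wc_complexity X b eps)%E.
Proof.
move=> p0; pose theta0 := theta_star X b + const_mx 1.
have H : theta0 != theta_star X b.
  rewrite -subr_eq0 /theta0 addrC addKr; apply/eqP => /matrixP/(_ (Ordinal p0) 0).
  by rewrite !mxE => /eqP; rewrite oner_eq0.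
apply: le_trans (ereal_sup_ubound _); last by exists theta0.
by apply: (@iter_complexity_ge _ _ _ _ _ _ _ _ 0).
Qed.

(** Start far away along an eigenvector for the smallest nonzero eigenvalue: the
    excess loss over the minimum is multiplied by [(1 - mu / L) ^+ 2] at each step,
    and the gap between the loss at the reference point and the minimal loss
    becomes negligible in the stopping rule. *)
Lemma wc_complexity_gt X b (eps : R) (k : nat) : (0 < n)%N ->
  column_space X^T b -> 0 < eps -> eps < 1 -> X != 0 ->
  let L := lambda_max (gram X) in let mu := mu_min (gram X) in
  k%:R < (L - mu) / (2 * mu) * ln (1 / eps) ->
  ((k.+1%:R : R)%:E <= wc_complexity X b eps)%E.
Proof.
move=> n0 bX eps0 eps1 X0 L mu kR.
have [v [v0 vmu mu0 _]] := mu_min_spec n0 X0; rewrite -/mu in vmu mu0.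
have sS := gram_sym X; set S := gram X in sS vmu *.
have [theta thetaE] := column_space_gram n0 bX; rewrite -/S in thetaE.
have muL : mu < L.
  have lneps : 0 < ln (1 / eps) by rewrite ln_gt0 // div1r invf_gt1.
  have : 0 < (L - mu) / (2 * mu) * ln (1 / eps) by rewrite (le_lt_trans _ kR).
  rewrite pmulr_lgt0 // pmulr_lgt0 ?invr_gt0 ?mulr_gt0 // subr_gt0 //.
have vv : 0 < dot v v by rewrite dotv_gt0.
set rho := 1 - L^-1 * mu.
have rho0 : 0 <= rho.
  by rewrite subr_ge0 mulrC ler_pdivrMr ?mul1r ?ltW //; apply: lt_trans muL.
have rho1 : rho <= 1 by rewrite gerBl mulr_ge0 ?invr_ge0 // ltW // (lt_trans mu0).
have rhok : eps < (rho ^+ k) ^+ 2 by exact: contraction_power_gt.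
set q := quad_loss S b; set thstar := theta_star X b.
pose e := 2^-1 * (mu * dot v v).
have e0 : 0 < e by rewrite !mulr_gt0 // invr_gt0.
(* [s] exceeds the size [D] at which the contracted excess loss covers the gap *)
pose D := (1 - eps) * `|q thstar - q theta| / (e * ((rho ^+ k) ^+ 2 - eps)).
pose s := D + 1.
have D0 : 0 <= D.
  by rewrite divr_ge0 // mulr_ge0 // ?subr_ge0 ltW.
pose w := s *: v^T.
have Sw : S *m w = mu *: w.
  rewrite -scalemxAr scalerA mulrC -scalerA; congr (_ *: _).
  by rewrite -{1}sS -trmx_mul vmu linearZ.
have qt t : q (theta + rho ^+ t *: w) - q theta = s ^+ 2 * (rho ^+ t) ^+ 2 * e.
  rewrite /q quad_loss_shift // addrAC subrr add0r /w scalerA [(_ *: v^T)^T]linearZ /= trmxK.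
  by rewrite -scalemxAl dotZl dotZr vmu dotZl /e; ring.
have gap t : (t <= k)%N ->
  eps * (q (theta + w) - q thstar) < q (theta + rho ^+ t *: w) - q thstar.
  move=> tk; have := qt 0%N; rewrite expr0 scale1r expr1n mulr1 => q0.
  have qE : q (theta + w) = s ^+ 2 * e + q theta by rewrite -q0 subrK.
  have {}qt : q (theta + rho ^+ t *: w) = s ^+ 2 * (rho ^+ t) ^+ 2 * e + q theta.
    by rewrite -qt subrK.
  rewrite qE qt -subr_gt0.
  have kt : (rho ^+ k) ^+ 2 <= (rho ^+ t) ^+ 2.
    by rewrite ler_pXn2r ?nnegrE ?exprn_ge0 // ler_wiXn2l.
  have s1 : s <= s ^+ 2 by rewrite expr2 ler_peMl /s //; lra.
  have H1 : s * (e * ((rho ^+ k) ^+ 2 - eps)) <= s ^+ 2 * (e * ((rho ^+ t) ^+ 2 - eps)).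
    apply: ler_pM => //; first by rewrite /s; lra.
      by rewrite mulr_ge0 ?subr_ge0 ?ltW.
    by rewrite ler_pM2l // lerD2r.
  have H2 : (1 - eps) * `|q thstar - q theta| < s * (e * ((rho ^+ k) ^+ 2 - eps)).
    by rewrite -ltr_pdivrMr ?mulr_gt0 ?subr_gt0 // /s -/D ltrDl.
  have H3 : (1 - eps) * (q thstar - q theta) <= (1 - eps) * `|q thstar - q theta|.
    by rewrite ler_pM2l ?subr_gt0 // ler_norm.
  rewrite (_ : _ - _ = s ^+ 2 * (e * ((rho ^+ t) ^+ 2 - eps)) -
                       (1 - eps) * (q thstar - q theta)); last by ring.
  lra.
have ne : theta + w != thstar.
  apply/eqP => E; have := gap 0%N isT; rewrite expr0 scale1r E subrr mulr0.
  by rewrite ltxx.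
apply: le_trans (ereal_sup_ubound _); last by exists (theta + w).
apply: iter_complexity_ge => t tk.
by rewrite (gd_eigenvector _ _ thetaE Sw) -/rho; exact: gap.
Qed.

Lemma wc_complexity_lower X b (eps : R) : (0 < n)%N -> (0 < p)%N ->
  column_space X^T b -> 0 < eps -> eps < 1 ->
  let L := lambda_max (gram X) in let mu := mu_min (gram X) in
  (((Num.ceil ((L - mu) / (2 * mu) * ln (1 / eps)))%:~R : R)%:E
    <= wc_complexity X b eps)%E.
Proof.
move=> n0 p0 bX eps0 eps1; cbv zeta.
set L := lambda_max _; set mu := mu_min _; set x := _ * _.
have wc0 : (0 <= wc_complexity X b eps)%E by exact: wc_complexity_ge0.
have [X0|X0] := eqVneq X 0.
  have mu0 : mu = 0.
    rewrite /mu /mu_min (_ : [set a | _] = set0) ?inf0 //.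
    apply/seteqP; split => // a /= [/eigenvalueP[v]].
    rewrite /gram X0 mulmx0 scaler0 mulmx0 => /esym/eqP.
    by rewrite scaler_eq0 => /orP[/eqP -> _|->] //; rewrite eqxx.
  by rewrite /x mu0 mulr0 invr0 mulr0 mul0r ceil0.
have [x0|x0] := leP x 0.
  by apply: le_trans wc0; rewrite lee_fin lerz0 ceil_le0.
have c0 : 0 < Num.ceil x by rewrite ceil_gt0.
case: (Num.ceil x) (ceil_itv x) c0 => [[//|k]|//] /andP[kx _] _.
by apply: wc_complexity_gt => //; move: kx; rewrite -addn1 PoszD addrK.
Qed.

End WorstCase.

(** * The smallest nonzero eigenvalue and residuals of rows *)

Section ResidualProjector.
Context {R : realType} {p : nat}.
Implicit Types (x : nat -> 'rV[R]_p) (u v w : 'rV[R]_p).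

(** The orthogonal projector onto the complement of the span of [x 0, .., x k.-1],
    by Gram-Schmidt. When [x k] lies in that span the residual is zero, and so is
    its inverse squared norm: the projector does not change. *)
Fixpoint residual_proj x k : 'M[R]_p :=
  if k is k'.+1 then
    let Q := residual_proj x k' in let r := x k' *m Q in
    Q - (dot r r)^-1 *: (r^T *m r)
  else 1%:M.

Lemma mulmx_dot u v w : u *m (v^T *m w) = dot u v *: w.
Proof. by rewrite mulmxA [u *m v^T]mx11_scalar mul_scalar_mx. Qed.

Lemma residual_proj_sym x k : (residual_proj x k)^T = residual_proj x k.
Proof.
elim: k => [|k IH] /=; first exact: trmx1.
by rewrite linearB /= IH linearZ /= trmx_mul trmxK.
Qed.

Lemma residual_proj_idem x k :
  residual_proj x k *m residual_proj x k = residual_proj x k.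
Proof.
elim: k => [|k IH] /=; first exact: mulmx1.
set Q := residual_proj x k; set r := x k *m Q; set c := (dot r r)^-1.
have QT : Q^T = Q := residual_proj_sym x k.
have rQ : r *m Q = r by rewrite /r -mulmxA IH.
set M := r^T *m r.
have MQ : M *m Q = M by rewrite /M -mulmxA rQ.
have QM : Q *m M = M by rewrite -[in LHS]QT mulmxA -trmx_mul rQ.
have MM : M *m M = dot r r *: M by rewrite {1}/M -mulmxA mulmx_dot -scalemxAr.
rewrite mulmxBl !mulmxBr IH -!scalemxAr -!scalemxAl MQ QM MM !scalerA.
have -> : c * c * dot r r = c.
  rewrite /c; have [->|r0] := eqVneq (dot r r) 0; first by rewrite mulr0 invr0.
  by rewrite -mulrA mulVf ?mulr1.
by rewrite subrr subr0.
Qed.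

Lemma residual_proj_self_dual x k u v :
  dot (u *m residual_proj x k) (v *m residual_proj x k) =
  dot (u *m residual_proj x k) v.
Proof.
by rewrite -dot_mulmxC ?residual_proj_sym // -mulmxA residual_proj_idem.
Qed.

Lemma residual_proj_annihilates x k i : (i < k)%N -> x i *m residual_proj x k = 0.
Proof.
elim: k => // k IH ik /=; set Q := residual_proj x k; set r := x k *m Q.
rewrite mulmxBr -scalemxAr mulmx_dot.
have rE u : dot u r = dot (u *m Q) r.
  by rewrite residual_proj_self_dual dot_mulmxC ?residual_proj_sym.
rewrite scalerA (rE (x i)); have [ik'|ki] := ltnP i k.
  by rewrite (IH ik') dot0l mulr0 scale0r subrr.
have -> : i = k by apply/eqP; rewrite eqn_leq ki -ltnS ik.
rewrite -/r; have [r0|r0] := eqVneq (dot r r) 0.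
  by rewrite r0 mulr0 scale0r subr0; apply/eqP; rewrite -dotv_eq0 r0.
by rewrite mulVf // scale1r subrr.
Qed.

Lemma residual_proj_sub m x k u (U : 'M[R]_(m, p)) :
  (forall i, (i < k)%N -> (x i <= U)%MS) -> (u - u *m residual_proj x k <= U)%MS.
Proof.
elim: k u => [|k IH] u xU /=; first by rewrite mulmx1 subrr sub0mx.
have {}IH w : (w - w *m residual_proj x k <= U)%MS.
  by apply: IH => i ik; apply: xU; exact: ltnW.
rewrite mulmxBr -scalemxAr mulmx_dot scalerA opprB addrCA addrC.
rewrite addmx_sub // scalemx_sub //.
by rewrite -(subKr (x k) (_ *m _)) addmx_sub ?eqmx_opp // xU.
Qed.

(** Each step removes the line of the residual from the range of the projector. *)
Lemma residual_proj_trace x k :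
  \tr (residual_proj x k.+1) =
  \tr (residual_proj x k) - (x k *m residual_proj x k != 0)%:R.
Proof.
rewrite /= linearB linearZ /= mxtrace_mulC trace_mx11 -/(dot _ _) -dotv_eq0.
by case: eqP => [->|/eqP r0]; rewrite ?mulr0 // mulVf.
Qed.

End ResidualProjector.

Section SmallestEigenvalueBound.
Context {R : realType} {n p : nat}.
Implicit Types X : 'M[R]_(n, p).

(** Gram-Schmidt recurses on the index of the row, whence a sequence indexed by [nat];
    it is zero after the last row. *)
Definition row_seq X (k : nat) : 'rV[R]_p :=
  oapp (fun i => row i X) 0 (insub k).

Lemma row_seqE X (i : 'I_n) : row_seq X i = row i X.
Proof. by rewrite /row_seq valK. Qed.

Lemma row_seq_sub X k : (row_seq X k <= X)%MS.
Proof. by rewrite /row_seq; case: insub => [i|] /=; rewrite ?row_sub ?sub0mx. Qed.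

(** A nonzero residual [v] of a row is a test vector in the row space of [X]; it is
    orthogonal to the first [m] rows, and its inner product with any other row is
    that with the residual of this row. *)
Lemma mu_min_residual_bound X m i : (0 < n)%N ->
  row_seq X i *m residual_proj (row_seq X) m != 0 ->
  n%:R * mu_min (gram X) <= \sum_(j < n | (m <= j)%N)
    dot (row j X *m residual_proj (row_seq X) m)
        (row j X *m residual_proj (row_seq X) m).
Proof.
move=> n0; set Q := residual_proj _ m; set v := _ *m Q => v0.
have vX : (v <= X)%MS.
  rewrite -(subKr (row_seq X i) v) addmx_sub ?row_seq_sub // eqmx_opp.
  by apply: residual_proj_sub => j _; exact: row_seq_sub.
have X0 : X != 0.
  apply: contraNneq v0 => X0; have := vX; rewrite X0 => v0.
  by apply/eqP; exact: submx0null v0.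
have [_ [_ _ _ /(_ _ vX)]] := mu_min_spec n0 X0.
have n1 : 0 < n%:R :> R by rewrite ltr0n.
rewrite gram_form_sum ler_pdivlMl // mulrA => H.
have vv : 0 < dot v v by rewrite dotv_gt0.
rewrite -(ler_pM2r vv); apply: le_trans H _.
rewrite (bigID (fun j : 'I_n => (m <= j)%N)) /= [X in _ + X]big1 ?addr0; last first.
  move=> j; rewrite -ltnNge => jm; rewrite -row_seqE.
  rewrite dotC -residual_proj_self_dual dotC residual_proj_annihilates //.
  by rewrite dot0l expr0n.
rewrite mulr_suml; apply: ler_sum => j _.
rewrite (_ : dot (row j X) v = dot (row j X *m Q) v) ?cauchy_schwarz //.
by rewrite dotC -residual_proj_self_dual dotC.
Qed.

End SmallestEigenvalueBound.

(** * Centered normal laws *)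

Section NormalLaw.
Context {R : realType}.
Local Notation mu := (@lebesgue_measure R).
Implicit Types (s : R) (f : R -> \bar R).

(** By uniqueness of the Radon-Nikodym derivative, the density is the one given in
    the definition of the law. *)
Lemma ge0_integral_normal_prob (m : R) s f : measurable_fun setT f ->
  (forall x, (0 <= f x)%E) ->
  (\int[normal_prob m s]_x f x = \int[mu]_x (f x * (normal_pdf m s x)%:E))%E.
Proof.
move=> mf f0; have dom := @normal_prob_dominates R m s.
rewrite -(Radon_Nikodym_SigmaFinite.change_of_variables dom) //.
apply: ae_eq_integral => //.
- apply: emeasurable_funM => //; apply: (measurable_int mu).
  exact: Radon_Nikodym_SigmaFinite.f_integrable.
- apply: emeasurable_funM => //; apply/measurable_EFinP.
  exact: measurable_normal_pdf.
- apply: ae_eqe_mul2l; apply: integral_ae_eq => //.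
  + exact: Radon_Nikodym_SigmaFinite.f_integrable.
  + by apply/measurable_EFinP; exact: measurable_normal_pdf.
  + by move=> E _ mE; rewrite -Radon_Nikodym_SigmaFinite.f_integral.
Qed.

Lemma normal_pdf_mulE (m s x : R) : s != 0 ->
  normal_pdf m s x = normal_peak s * normal_fun m s x.
Proof. by move=> s0; rewrite normal_pdfE. Qed.

(** Three quarters of the exponent absorb the factor [y ^+ 2]; the remaining quarter
    is the exponent for the doubled standard deviation. *)
Lemma normal_pdf_sqr_le s (y : R) : 0 < s ->
  y ^+ 2 * normal_pdf 0 s y <= 6 * s ^+ 2 * normal_pdf 0 (2 * s) y.
Proof.
move=> s0; have s20 : 2 * s != 0 by rewrite mulf_neq0 ?gt_eqF.
rewrite (normal_pdf_mulE _ _ s20) (normal_pdf_mulE _ _ (lt0r_neq0 s0)) /normal_fun subr0.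
have -> : normal_peak s = 2 * normal_peak (2 * s).
  rewrite /normal_peak (_ : (2 * s) ^+ 2 * pi *+ 2 = 2 ^+ 2 * (s ^+ 2 * pi *+ 2)); last first.
    by rewrite exprMn -mulrA -mulrnAr.
  by rewrite sqrtrM ?sqr_ge0 // sqrtr_sqr ger0_norm // invfM mulrA divff ?mul1r.
have peak0 := normal_peak_ge0 (2 * s).
set t := 3 * y ^+ 2 / (8 * s ^+ 2).
have yt : y ^+ 2 <= 8 / 3 * s ^+ 2 * expR t.
  rewrite [leLHS](_ : _ = 8 / 3 * s ^+ 2 * t); last first.
    by rewrite /t; field; rewrite gt_eqF.
  rewrite ler_wpM2l //; first by rewrite mulr_ge0 ?sqr_ge0 // divr_ge0.
  by apply: le_trans (expR_ge1Dx t); rewrite lerDr.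
rewrite (_ : - y ^+ 2 / (s ^+ 2 *+ 2) = - t + - y ^+ 2 / ((2 * s) ^+ 2 *+ 2)); last first.
  by rewrite /t; field; rewrite gt_eqF.
rewrite expRD; set e := expR (_ / _); have e0 : 0 <= e by exact: expR_ge0.
rewrite (_ : _ * _ = (y ^+ 2 * expR (- t)) * (2 * (normal_peak (2 * s) * e))); last by ring.
have : y ^+ 2 * expR (- t) <= 8 / 3 * s ^+ 2.
  by rewrite expRN ler_pdivrMr ?expR_gt0.
have pe : 0 <= 2 * (normal_peak (2 * s) * e) by rewrite !mulr_ge0.
move=> /(ler_wpM2r pe) /le_trans; apply.
rewrite (_ : 6 * _ * _ = (3 * s ^+ 2) * (2 * (normal_peak (2 * s) * e))); last by ring.
by rewrite ler_wpM2r // ler_wpM2r ?sqr_ge0 //; lra.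
Qed.

Lemma normal_second_moment_le s : 0 < s ->
  (\int[normal_prob 0 s]_x (x ^+ 2)%:E <= (6 * s ^+ 2)%:E)%E.
Proof.
move=> s0; rewrite ge0_integral_normal_prob //; last 2 first.
- by apply/measurable_EFinP; exact: measurable_funX.
- by move=> x; rewrite lee_fin sqr_ge0.
have H : (\int[mu]_x ((6 * s ^+ 2)%:E * (normal_pdf 0 (2 * s) x)%:E) = (6 * s ^+ 2)%:E)%E.
  rewrite ge0_integralZl_EFin //; first by rewrite integral_normal_pdf mule1.
  - by move=> x _; rewrite lee_fin normal_pdf_ge0.
  - by apply/measurable_EFinP; exact: measurable_normal_pdf.
  - by rewrite mulr_ge0 ?sqr_ge0.
rewrite -[leRHS]H; apply: ge0_le_integral => //.
- by move=> x _; rewrite mule_ge0 // lee_fin ?sqr_ge0 ?normal_pdf_ge0.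
- apply: emeasurable_funM; apply/measurable_EFinP; last exact: measurable_normal_pdf.
  exact: measurable_funX.
- apply: emeasurable_funM => //; apply/measurable_EFinP; exact: measurable_normal_pdf.
- by move=> x _; rewrite -!EFinM lee_fin normal_pdf_sqr_le.
Qed.

Lemma normal_prob_ball_le s (r : R) : 0 < s -> 0 <= r ->
  (normal_prob 0 s [set x | `|x| < r]%R <= (2 * r * normal_peak s)%:E)%E.
Proof.
move=> s0 r0; have -> : [set x | `|x| < r]%R = `]- r, r[%classic.
  by apply/seteqP; split => x /=; rewrite in_itv /= ltr_norml.
rewrite [leLHS]/normal_prob.
apply: (@le_trans _ _ (\int[mu]_(x in `](- r)%R, r[) (normal_peak s)%:E)%E).
  apply: ge0_le_integral => //.
  - by move=> x _; rewrite lee_fin normal_pdf_ge0.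
  - apply/measurable_EFinP; apply: measurable_funTS; exact: measurable_normal_pdf.
  - by move=> x _; rewrite lee_fin normal_pdf_ub // gt_eqF.
rewrite integral_cst //= lebesgue_measure_itv /= lte_fin.
have pk := normal_peak_ge0 s.
case: ifPn => _; last by rewrite mule0 lee_fin !mulr_ge0.
by rewrite -EFinD -EFinM lee_fin opprK mulrC mulrDl mulr_natl mulr2n mulrDl.
Qed.

Lemma normal_prob0 s : 0 < s -> normal_prob 0 s [set 0 : R] = 0%E.
Proof.
move=> s0; have /null_content_dominatesP := @normal_prob_dominates R 0 s.
by move=> H; apply: H; [exact: measurable_set1|exact: lebesgue_measure_set1].
Qed.

Lemma normal_peak_le (s t : R) : 0 < s -> s <= t -> normal_peak t <= normal_peak s.
Proof.
move=> s0 st; have t0 : 0 < t by exact: lt_le_trans st.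
rewrite /normal_peak lef_pV2 ?posrE ?sqrtr_gt0;
  try by rewrite pmulrn_rgt0 // mulr_gt0 ?pi_gt0 ?exprn_gt0.
rewrite ler_wsqrtr // lerMn2r /= ler_wpM2r ?pi_ge0 //.
by rewrite ler_pXn2r ?nnegrE // ltW.
Qed.

End NormalLaw.

(** * Independence and partial integration *)

Section Decoupling.
Local Open Scope ereal_scope.
Context d d1 d2 (T : measurableType d) (T1 : measurableType d1)
  (T2 : measurableType d2) (R : realType) (P : probability T R).

Lemma measurable_partial_integral (Y : T -> T1) (Z : T -> T2)
    (f : T1 * T2 -> \bar R) :
  measurable_fun setT Y -> measurable_fun setT Z ->
  measurable_fun [set: T1 * T2] f -> (forall x, 0 <= f x) ->
  measurable_fun setT (fun w => \int[P]_v f (Y w, Z v)).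
Proof.
move=> mY mZ mf f0.
pose Z' : {mfun T >-> T2} := HB.pack Z (isMeasurableFun.Build _ _ _ _ _ mZ).
apply: (eq_measurable_fun (fubini_F (distribution P Z') f \o Y)).
  move=> w _; rewrite /= /fubini_F ge0_integral_distribution //.
  exact: measurableT_comp.
by apply: measurableT_comp => //; exact: measurable_fun_fubini_tonelli_F.
Qed.

(** The joint law of two independent variables is the product of their laws, so
    Tonelli integrates one of them out with the other one frozen. *)
Lemma integral_decoupling (Y : T -> T1) (Z : T -> T2) (f : T1 * T2 -> \bar R) :
  measurable_fun setT Y -> measurable_fun setT Z ->
  (forall A B, measurable A -> measurable B ->
    P (Y @^-1` A `&` Z @^-1` B) = P (Y @^-1` A) * P (Z @^-1` B)) ->
  measurable_fun [set: T1 * T2] f -> (forall x, 0 <= f x) ->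
  \int[P]_w f (Y w, Z w) = \int[P]_w \int[P]_v f (Y w, Z v).
Proof.
move=> mY mZ indep mf f0.
pose Y' : {mfun T >-> T1} := HB.pack Y (isMeasurableFun.Build _ _ _ _ _ mY).
pose Z' : {mfun T >-> T2} := HB.pack Z (isMeasurableFun.Build _ _ _ _ _ mZ).
have mYZ : measurable_fun setT (fun w => (Y w, Z w)).
  exact/measurable_fun_pairP.
pose YZ : {mfun T >-> (T1 * T2)%type} :=
  HB.pack (fun w => (Y w, Z w)) (isMeasurableFun.Build _ _ _ _ _ mYZ).
transitivity (\int[distribution P YZ]_x f x).
  by rewrite ge0_integral_distribution.
transitivity (\int[distribution P Y' \x distribution P Z']_x f x).
  apply: eq_measure_integral => A mA _; apply/esym.
  by apply: product_measure_unique => // B C mB mC; rewrite -indep.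
rewrite fubini_tonelli1 //.
rewrite ge0_integral_distribution //=; last 2 first.
- exact: measurable_fun_fubini_tonelli_F.
- by move=> y; apply: integral_ge0.
apply: eq_integral => w _; rewrite /= /fubini_F.
rewrite ge0_integral_distribution //.
exact: measurableT_comp.
Qed.

End Decoupling.

Section Blocks.
Context d (T : measurableType d) (R : realType) (P : probability T R).
Variables (n : nat) (F : 'I_n -> set (set T)).

(** A pi-system which generates the sigma-algebra of the indices before [k]. *)
Definition past_events k : set (set T) :=
  [set A | exists2 E : 'I_n -> set T, forall i : 'I_n, (i < k)%N -> F i (E i) &
    A = \big[setI/setT]_(i < n | (i < k)%N) E i].

Hypothesis F_sigma : forall i, sigma_algebra setT (F i).
Hypothesis F_measurable : forall i A, F i A -> measurable A.

Let FT i : F i setT.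
Proof. by have /sigma_algebraP[] := F_sigma i. Qed.

Let FI i : setI_closed (F i).
Proof. by have /sigma_algebraP[] := F_sigma i. Qed.

Lemma past_events_setI k : setI_closed (past_events k).
Proof.
move=> _ _ [A FA ->] [B FB ->]; exists (fun i => A i `&` B i); last first.
  by rewrite big_split.
by move=> i ik; apply: FI; [exact: FA|exact: FB].
Qed.

Lemma past_events_measurable k : past_events k `<=` measurable.
Proof.
move=> _ [E FE ->]; apply: bigsetI_measurable => i ik.
by apply: F_measurable; exact: FE.
Qed.

Lemma past_events_setT k : past_events k setT.
Proof. by exists (fun=> setT) => // ; rewrite big1. Qed.

Lemma past_events_sub k (i : 'I_n) : (i < k)%N -> F i `<=` past_events k.
Proof.
move=> ik A FA; exists (fun j => if j == i then A else setT) => [j _|].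
  by case: eqP => [->|_] //; exact: FT.
rewrite (bigD1 i) //= eqxx big1 ?setIT // => j /andP[_ ji].
by rewrite (negbTE ji).
Qed.

(** Mutual independence gives the product rule on finite intersections of past
    events; both sides are measures in the first event, so it extends to the
    sigma-algebra which these intersections generate. *)
Lemma past_events_indep k (i : 'I_n) A B : mutually_independent P F -> (k <= i)%N ->
  <<s past_events k >> A -> F i B -> P (A `&` B) = (P A * P B)%E.
Proof.
move=> indep ki sA FB; have mB := F_measurable FB.
have PBfin : P B \is a fin_num by rewrite fin_num_measure.
have r0 : 0 <= fine (P B) by rewrite fine_ge0.
rewrite muleC -[P B]fineK // -/(mrestr P mB A).
rewrite -[RHS]/(mscale (NngNum r0) P A).
apply: (@g_sigma_algebra_measure_unique _ R T (past_events k) _ (fun=> setT)) => //.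
- exact: past_events_measurable.
- by move=> _; exact: past_events_setT.
- by rewrite bigcup_const //; exists 0.
- exact: past_events_setI.
- move=> _ [E FE ->]; set EA := \big[_/_]_(_ < _ | _) _.
  rewrite -[LHS]/(P (EA `&` B)) -[RHS]/((fine (P B))%:E * P EA)%E fineK //.
  pose E' (j : 'I_n) := if (j < k)%N then E j else B.
  have prodE (J : {set 'I_n}) : (forall j, j \in J -> (j < k)%N || (j == i)) ->
      P (\big[setI/setT]_(j in J) E' j) = (\prod_(j in J) P (E' j))%E.
    move=> HJ; apply: indep => j /HJ; rewrite /E'.
    by case: ltnP => [jk _|_ /eqP ->] //; exact: FE.
  pose J : {set 'I_n} := finset (fun j : 'I_n => (j < k)%N).
  have inJ j : (j \in J) = (j < k)%N by rewrite /J finset.in_set.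
  have iJ : i \notin J by rewrite inJ -leqNgt.
  have E'i : E' i = B by rewrite /E' ltnNge ki.
  have JE : \big[setI/setT]_(j in J) E' j = EA.
    by apply: eq_big => j; rewrite inJ // /E' => ->.
  have := prodE (i |: J)%SET; rewrite !big_setU1 //= E'i JE setIC => -> => [|j]; last first.
    by rewrite finset.in_setU1 inJ orbC.
  by rewrite -prodE ?JE // => j; rewrite inJ => ->.
- by move=> _; rewrite -[X in (X < _)%E]/(P (setT `&` B)) setTI ltey_eq PBfin.
Qed.

End Blocks.

(** * Gaussian rows *)

Section MeasurableEntries.
Context d (T : measurableType d) (R : realType).

Lemma measurable_mulmx m n p (A : T -> 'M[R]_(m, n)) (B : T -> 'M[R]_(n, p)) :
  (forall i j, measurable_fun setT (fun w => A w i j)) ->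
  (forall i j, measurable_fun setT (fun w => B w i j)) ->
  forall i j, measurable_fun setT (fun w => (A w *m B w) i j).
Proof.
move=> mA mB i j; under eq_fun do rewrite mxE.
by apply: measurable_sum => l; exact: measurable_funM.
Qed.

Lemma measurable_dot p (u v : T -> 'rV[R]_p) :
  (forall j, measurable_fun setT (fun w => u w 0 j)) ->
  (forall j, measurable_fun setT (fun w => v w 0 j)) ->
  measurable_fun setT (fun w => dot (u w) (v w)).
Proof.
move=> mu mv; under eq_fun do rewrite dotE.
by apply: measurable_sum => l; exact: measurable_funM.
Qed.

Lemma measurable_mxtrace p (A : T -> 'M[R]_p) :
  (forall i j, measurable_fun setT (fun w => A w i j)) ->
  measurable_fun setT (fun w => \tr (A w)).
Proof. by move=> mA; apply: measurable_sum. Qed.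

Lemma measurable_residual_proj p (x : T -> nat -> 'rV[R]_p) k :
  (forall i j, (i < k)%N -> measurable_fun setT (fun w => x w i 0 j)) ->
  forall i j, measurable_fun setT (fun w => residual_proj (x w) k i j).
Proof.
elim: k => [|k IH] mx i j /=; first exact: measurable_cst.
have {}IH : forall i j, measurable_fun setT (fun w => residual_proj (x w) k i j).
  by apply: IH => a b ak; apply: mx; exact: ltnW.
have mr b : measurable_fun setT (fun w => (x w k *m residual_proj (x w) k) 0 b).
  by apply: measurable_mulmx => // a c; rewrite ord1; exact: mx.
have entryE (Q : 'M[R]_p) c (r : 'rV[R]_p) :
    (Q - c *: (r^T *m r)) i j = Q i j - c * (r 0 i * r 0 j).
  by rewrite !mxE big_ord1 mxE.
under eq_fun do rewrite entryE.
apply: measurable_funB => //; apply: measurable_funM; last exact: measurable_funM.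
(* The inverse of a nonnegative number is a real power of it. *)
under eq_fun do rewrite -powR_inv1 ?dotv_ge0 //.
by apply: (measurableT_comp (measurable_powR _)); exact: measurable_dot.
Qed.

End MeasurableEntries.

Section GaussianRows.
Context d (T : measurableType d) (R : realType) (P : probability T R).
Variables (n p : nat) (X : T -> 'M[R]_(n, p)) (Sigma : 'M[R]_p) (c_m c_M : R).
Hypothesis X_iid : iid_gaussian_rows P X Sigma.
Hypothesis c_m_gt0 : 0 < c_m.
Hypothesis Sigma_ge : forall u, c_m * dot u u <= dot (u *m Sigma) u.
Hypothesis Sigma_le : forall u, dot (u *m Sigma) u <= c_M * dot u u.

Let mX i j : measurable_fun setT (fun w => X w i j).
Proof. by have [mX _ _] := X_iid; exact: mX. Qed.

Lemma measurable_row_dot i v : measurable_fun setT (fun w => dot (row i (X w)) v).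
Proof.
apply: measurable_dot => j; last exact: measurable_cst.
by under eq_fun do rewrite mxE; exact: mX.
Qed.

Lemma row_dot_law i v (B : set R) : v != 0 -> measurable B ->
  P [set w | B (dot (row i (X w)) v)] =
  normal_prob 0 (Num.sqrt (dot (v *m Sigma) v)) B.
Proof.
move=> v0 mB; have [_ gX _] := X_iid.
rewrite /dot gX // /centered_normal trmxK -/(dot (v *m Sigma) v).
by rewrite gt_eqF // (lt_le_trans _ (Sigma_ge v)) // mulr_gt0 // dotv_gt0.
Qed.

Let sqrt_form_gt0 v : v != 0 -> 0 < Num.sqrt (dot (v *m Sigma) v).
Proof.
move=> v0; rewrite sqrtr_gt0 (lt_le_trans _ (Sigma_ge v)) //.
by rewrite mulr_gt0 // dotv_gt0.
Qed.

Lemma row_dot_eq0_null i v : v != 0 ->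
  P [set w | dot (row i (X w)) v = 0] = 0%E.
Proof.
move=> v0; rewrite (row_dot_law i v0 (measurable_set1 0)).
exact/normal_prob0/sqrt_form_gt0.
Qed.

Lemma row_dot_small i v (r : R) : v != 0 -> 0 <= r ->
  (P [set w | `|dot (row i (X w)) v| < r]%R <=
     (2 * r * normal_peak (Num.sqrt (c_m * dot v v)))%:E)%E.
Proof.
move=> v0 r0; rewrite (@row_dot_law i v [set y | `|y| < r]%R) //; last first.
  rewrite (_ : [set _ | _] = `]- r, r[%classic) //.
  by apply/seteqP; split => y /=; rewrite in_itv /= ltr_norml.
apply: le_trans (normal_prob_ball_le (sqrt_form_gt0 v0) r0) _.
rewrite lee_fin ler_wpM2l ?mulr_ge0 // normal_peak_le ?ler_wsqrtr //.
by rewrite sqrtr_gt0 mulr_gt0 // dotv_gt0.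
Qed.

Lemma row_dot_second_moment i v :
  (\int[P]_w (dot (row i (X w)) v ^+ 2)%:E <= (6 * c_M * dot v v)%:E)%E.
Proof.
have [->|v0] := eqVneq v 0.
  rewrite dot0l mulr0 integral0_eq // => w _.
  by rewrite dotC dot0l expr0n.
(* the Lebesgue measurable structure, on which normal laws are defined *)
pose GR := measurableTypeR R; pose y w : GR := dot (row i (X w)) v.
have my : measurable_fun setT y := measurable_row_dot i v.
pose Y : {mfun T >-> GR} := HB.pack y (isMeasurableFun.Build _ _ _ _ _ my).
have msq : measurable_fun setT (fun y : GR => (y ^+ 2)%:E).
  by apply/measurable_EFinP; exact: measurable_funX.
set s := Num.sqrt (dot (v *m Sigma) v).
rewrite [leLHS](_ : _ = \int[distribution P Y]_y (y ^+ 2)%:E)%E; last first.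
  by rewrite ge0_integral_distribution // => z; rewrite lee_fin sqr_ge0.
rewrite [leLHS](_ : _ = \int[normal_prob 0 s]_y (y ^+ 2)%:E)%E; last first.
  by apply: eq_measure_integral => A mA _; exact: row_dot_law.
apply: le_trans (normal_second_moment_le (sqrt_form_gt0 v0)) _.
rewrite lee_fin -mulrA ler_pM2l // sqr_sqrtr ?Sigma_le //.
by rewrite (le_trans _ (Sigma_ge v)) // mulr_ge0 ?dotv_ge0 // ltW.
Qed.

(** The squared norm of [x *m Q] is the sum of the squared inner products of [x] with
    the rows of [Q], and the squared norms of these rows add up to the trace. *)
Lemma row_proj_second_moment i (Q : 'M[R]_p) : Q^T = Q -> Q *m Q = Q ->
  (\int[P]_w (dot (row i (X w) *m Q) (row i (X w) *m Q))%:E <=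
    (6 * c_M * \tr Q)%:E)%E.
Proof.
move=> QT QQ.
have E (x : 'rV[R]_p) : dot (x *m Q) (x *m Q) = \sum_j dot x (row j Q) ^+ 2.
  rewrite dotE; apply: eq_bigr => j _; rewrite -expr2; congr (_ ^+ 2).
  by rewrite mxE dotE; apply: eq_bigr => l _; rewrite mxE -[in LHS]QT mxE.
under eq_integral do rewrite E -sumEFin.
rewrite ge0_integral_sum //; last 2 first.
- move=> j; apply/measurable_EFinP; apply: measurable_funX.
  exact: measurable_row_dot.
- by move=> j w _; rewrite lee_fin sqr_ge0.
apply: (@le_trans _ _ (\sum_j (6 * c_M * dot (row j Q) (row j Q))%:E)%E).
  by apply: lee_sum => j _; exact: row_dot_second_moment.
rewrite sumEFin lee_fin -mulr_sumr -[in leRHS]QQ.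
rewrite (_ : \sum_j _ = \tr (Q *m Q)) //; apply: eq_bigr => j _.
rewrite dotE mxE; apply: eq_bigr => l _.
by rewrite !mxE -[in X in _ * X = _]QT mxE.
Qed.

Lemma row_proj_null i (Q : 'M[R]_p) : Q^T = Q -> Q != 0 ->
  P [set w | dot (row i (X w) *m Q) (row i (X w) *m Q) = 0] = 0%E.
Proof.
move=> QT Q0.
have /rowV0Pn[v vQ v0] := Q0; have [z vE] := submxP vQ.
apply/eqP; rewrite eq_le measure_ge0 andbT -(row_dot_eq0_null i v0).
apply: le_measure; rewrite ?inE.
- rewrite -[X in measurable X]setTI.
  apply: (measurable_dot _ _ measurableT (measurable_set1 0)) => j;
    apply: measurable_mulmx => a b; try exact: measurable_cst;
    by under eq_fun do rewrite mxE; exact: mX.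
- rewrite -[X in measurable X]setTI.
  exact: (measurable_row_dot i v measurableT (measurable_set1 0)).
- move=> w /= /eqP; rewrite dotv_eq0 => /eqP xQ.
  by rewrite vE -QT dotC dot_mulmx_tr trmxK xQ dotC dot0l.
Qed.

End GaussianRows.

(** * Residuals of Gaussian rows *)

Section RowIndependence.
Context d (T : measurableType d) (R : realType) (P : probability T R).
Variables (n p : nat) (X : T -> 'M[R]_(n, p)) (Sigma : 'M[R]_p).
Hypothesis X_iid : iid_gaussian_rows P X Sigma.

Let mX i j : measurable_fun setT (fun w => X w i j).
Proof. by have [mX _ _] := X_iid; exact: mX. Qed.

Definition row_generators (i : 'I_n) : set (set T) :=
  \big[setU/set0]_(j < p) preimage_set_system setT (fun w => X w i j) measurable.

Definition row_events (i : 'I_n) : set (set T) := <<s row_generators i >>.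

Lemma row_events_sigma_algebra i : sigma_algebra setT (row_events i).
Proof. exact: smallest_sigma_algebra. Qed.

Lemma row_generators_preimage i j (B : set R) : measurable B ->
  row_generators i ((fun w => X w i j) @^-1` B).
Proof.
move=> mB; rewrite /row_generators (bigD1 j) //=; left.
by exists B => //; rewrite setTI.
Qed.

Lemma row_events_measurable i A : row_events i A -> measurable A.
Proof.
move: A; apply: smallest_sub; first exact: sigma_algebra_measurable.
rewrite /row_generators; elim/big_ind : _ => //.
- by move=> A B sA sB C [/sA|/sB].
- by move=> j _ _ [B mB <-]; exact: mX.
Qed.

(** The sample space with the sigma-algebra of the rows before [k], resp. of the
    row [i] alone: the identity maps into them are independent when [k <= i]. *)
Definition past_space k := g_sigma_algebraType (past_events row_events k).
Definition row_space i := g_sigma_algebraType (row_generators i).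

Lemma measurable_past_entry k (i : 'I_n) j : (i < k)%N ->
  measurable_fun setT (fun w : past_space k => X w i j).
Proof.
move=> ik _ B mB; rewrite setTI; apply: sub_sigma_algebra.
apply: (past_events_sub row_events_sigma_algebra ik).
by apply: sub_sigma_algebra; exact: row_generators_preimage.
Qed.

Lemma measurable_row_entry i j :
  measurable_fun setT (fun w : row_space i => X w i j).
Proof.
move=> _ B mB; rewrite setTI; apply: sub_sigma_algebra.
exact: row_generators_preimage.
Qed.

Let measurable_id_past k : measurable_fun setT (id : T -> past_space k).
Proof.
move=> _ A mA; rewrite setTI; move: A mA.
apply: smallest_sub; first exact: sigma_algebra_measurable.
exact: (past_events_measurable row_events_measurable).
Qed.

Let measurable_id_row i : measurable_fun setT (id : T -> row_space i).
Proof. by move=> _ A mA; rewrite setTI; exact: (@row_events_measurable i). Qed.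

Lemma integral_past_row k (i : 'I_n) (f : past_space k * row_space i -> \bar R) :
  (k <= i)%N -> measurable_fun setT f -> (forall z, (0 <= f z)%E) ->
  (\int[P]_w f (w, w) = \int[P]_w \int[P]_v f (w, v))%E.
Proof.
move=> ki mf f0; have [_ _ indep] := X_iid.
apply: (@integral_decoupling _ _ _ T _ _ R P _ _ f
  (@measurable_id_past k) (@measurable_id_row i)) => // A B mA mB.
apply: (past_events_indep _ _ indep ki) => //.
- exact: row_events_sigma_algebra.
- by move=> j C; exact: row_events_measurable.
Qed.

Lemma measurable_integral_row k (i : 'I_n) (f : past_space k * row_space i -> \bar R) :
  measurable_fun setT f -> (forall z, (0 <= f z)%E) ->
  measurable_fun setT (fun w : T => \int[P]_v f (w, v))%E.
Proof.
exact: (@measurable_partial_integral _ _ _ T _ _ R P _ _ f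
  (@measurable_id_past k) (@measurable_id_row i)).
Qed.

End RowIndependence.

Section ResidualProbability.
Context d (T : measurableType d) (R : realType) (P : probability T R).
Variables (n p : nat) (X : T -> 'M[R]_(n, p)) (Sigma : 'M[R]_p) (c_m c_M : R).
Hypothesis X_iid : iid_gaussian_rows P X Sigma.
Hypothesis c_m_gt0 : 0 < c_m.
Hypothesis Sigma_ge : forall u, c_m * dot u u <= dot (u *m Sigma) u.
Hypothesis Sigma_le : forall u, dot (u *m Sigma) u <= c_M * dot u u.

Let mX i j : measurable_fun setT (fun w => X w i j).
Proof. by have [mX _ _] := X_iid; exact: mX. Qed.

Local Notation Q k w := (residual_proj (row_seq (X w)) k).

Definition residual_sqnorm k (i : 'I_n) (w v : T) : R :=
  dot (row i (X v) *m Q k w) (row i (X v) *m Q k w).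

Lemma residual_sqnorm_ge0 k i w v : 0 <= residual_sqnorm k i w v.
Proof. exact: dotv_ge0. Qed.

(** The space is arbitrary, because the lemma serves both for the original
    sigma-algebra and for that of the first [k] rows, which are all the projector
    depends on. *)
Lemma measurable_residual_proj_rows d' (T' : measurableType d') (Y : T' -> 'M[R]_(n, p)) k :
  (forall (i : 'I_n) j, (i < k)%N -> measurable_fun setT (fun w => Y w i j)) ->
  forall a b, measurable_fun setT (fun w => residual_proj (row_seq (Y w)) k a b).
Proof.
move=> mY; apply: measurable_residual_proj => i j ik.
rewrite /row_seq; case: insubP => [i' _ iE|_] /=.
  by under eq_fun do rewrite mxE; apply: mY; rewrite iE.
by under eq_fun do rewrite mxE; exact: measurable_cst.
Qed.

Lemma measurable_residual_sqnorm k (i : 'I_n) :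
  measurable_fun setT (fun z : past_space X k * row_space X i =>
    residual_sqnorm k i z.1 z.2).
Proof.
suff mr b : measurable_fun setT (fun z : past_space X k * row_space X i =>
    (row i (X z.2) *m Q k z.1) 0 b) by exact: measurable_dot.
apply: measurable_mulmx => [a c|a c].
  under eq_fun do rewrite mxE.
  apply: (@measurableT_comp _ _ _ _ _ _ (fun w : row_space X i => X w i c) _ snd) => //.
  exact: measurable_row_entry.
apply: (@measurableT_comp _ _ _ _ _ _ (fun w : past_space X k => Q k w a c) _ fst) => //.
by apply: measurable_residual_proj_rows => i' j ik; exact: measurable_past_entry.
Qed.

Lemma measurable_trace_past k :
  measurable_fun setT (fun w : past_space X k => \tr (Q k w)).
Proof.
apply: measurable_mxtrace; apply: measurable_residual_proj_rows => i j ik.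
exact: measurable_past_entry.
Qed.

Lemma measurable_trace k : measurable_fun setT (fun w => \tr (Q k w)).
Proof. by apply: measurable_mxtrace; apply: measurable_residual_proj_rows. Qed.

Lemma measurable_residual_sqnorm_diag k i :
  measurable_fun setT (fun w => residual_sqnorm k i w w).
Proof.
suff mr b : measurable_fun setT (fun w => (row i (X w) *m Q k w) 0 b).
  exact: measurable_dot.
apply: measurable_mulmx => [a c|]; last exact: measurable_residual_proj_rows.
by under eq_fun do rewrite mxE; exact: mX.
Qed.

(** Frozen in the inner integral, the projector is a constant, and the law of the row
    is still Gaussian. *)
Lemma residual_second_moment k (i : 'I_n) : (k <= i)%N ->
  (\int[P]_w (residual_sqnorm k i w w)%:E <=
   \int[P]_w (6 * c_M * \tr (Q k w))%:E)%E.
Proof.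
move=> ki.
pose f (z : past_space X k * row_space X i) : \bar R :=
  (residual_sqnorm k i z.1 z.2)%:E.
have mf : measurable_fun setT f.
  by apply/measurable_EFinP; exact: measurable_residual_sqnorm.
have f0 z : (0 <= f z)%E by rewrite lee_fin residual_sqnorm_ge0.
rewrite (integral_past_row X_iid ki mf f0); apply: ge0_le_integral => //.
- by move=> w _; exact: integral_ge0.
- exact: (measurable_integral_row X_iid mf f0).
- by apply/measurable_EFinP; apply: measurable_funM => //; exact: measurable_trace.
- move=> w _; rewrite /f /residual_sqnorm /=; move: (Q k w) (residual_proj_sym (row_seq (X w)) k)
    (residual_proj_idem (row_seq (X w)) k) => {f mf f0} Qw QT QQ.
  exact: (row_proj_second_moment X_iid c_m_gt0 Sigma_ge Sigma_le i QT QQ).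
Qed.

Lemma measurable_residual_vanish k i :
  measurable [set w | 0 < \tr (Q k w) /\ residual_sqnorm k i w w = 0].
Proof.
rewrite (_ : [set w | _] = (fun w => \tr (Q k w)) @^-1` `]0, +oo[%classic `&`
                 (fun w => residual_sqnorm k i w w) @^-1` [set 0]).
  apply: measurableI; rewrite -[X in measurable X]setTI.
    by apply: measurable_trace.
  by apply: measurable_residual_sqnorm_diag => //; exact: measurable_set1.
by apply/seteqP; split => z /=; rewrite in_itv /= andbT.
Qed.

(** A nonzero projector has a nonzero row, and with the first [k] rows frozen, the
    inner product of that row with the row [i] of the sample has a law without atoms. *)
Lemma residual_vanish_null k (i : 'I_n) : (k <= i)%N ->
  P [set w | 0 < \tr (Q k w) /\ residual_sqnorm k i w w = 0] = 0%E.
Proof.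
move=> ki.
pose A : set (past_space X k * row_space X i) :=
  [set z | 0 < \tr (Q k z.1) /\ residual_sqnorm k i z.1 z.2 = 0].
have mA : measurable A.
  rewrite (_ : A = (fun z => \tr (Q k z.1)) @^-1` `]0, +oo[%classic `&`
                   (fun z => residual_sqnorm k i z.1 z.2) @^-1` [set 0]).
    apply: measurableI; rewrite -[X in measurable X]setTI.
      apply: (@measurableT_comp _ _ _ _ _ _
        (fun w : past_space X k => \tr (Q k w)) _ fst) => //.
      exact: measurable_trace_past.
    by apply: measurable_residual_sqnorm => //; exact: measurable_set1.
  by apply/seteqP; split => z /=; rewrite in_itv /= andbT.
have mf : measurable_fun setT (fun z => (\1_A z : R)%:E).
  by apply/measurable_EFinP; exact: measurable_indic.
have f0 z : (0 <= (\1_A z : R)%:E)%E by rewrite lee_fin.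
have mB := measurable_residual_vanish k i.
rewrite -[X in P X]setIT -integral_indic //.
transitivity (\int[P]_w (\1_A (w, w) : R)%:E)%E.
  by apply: eq_integral => w _; rewrite !indicE; congr (_%:R%:E); apply/idP/idP; rewrite !inE.
rewrite (integral_past_row X_iid ki mf f0); apply: integral0_eq => w _.
have [trQ|trQ] := ltP 0 (\tr (Q k w)); last first.
  apply: integral0_eq => v _; rewrite indicE memNset // => -[/= +] _.
  by rewrite ltNge trQ.
have Q0 : Q k w != 0 by apply: contraTneq trQ => ->; rewrite mxtrace0 ltxx.
transitivity (\int[P]_v (\1_[set v | residual_sqnorm k i w v = 0] v : R)%:E)%E.
  apply: eq_integral => v _; rewrite !indicE; congr ((nat_of_bool _)%:R%:E).
  by apply/idP/idP; rewrite !inE /=; [case|].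
rewrite integral_indic // ?setIT.
  by apply: (row_proj_null X_iid c_m_gt0 Sigma_ge) => //; exact: residual_proj_sym.
rewrite -[X in measurable X]setTI.
suff mw : measurable_fun setT (residual_sqnorm k i w).
  exact: (mw measurableT _ (measurable_set1 0)).
apply: measurable_dot => j; apply: measurable_mulmx => a b; try exact: measurable_cst;
  by under eq_fun do rewrite mxE; exact: mX.
Qed.

End ResidualProbability.

(** * Ill-conditioned samples *)

Section LowerIntegral.
Import HBNNSimple.
Context d (T : measurableType d) (R : realType) (P : {measure set T -> \bar R}).

(** The integral of a nonnegative function is the supremum over the simple functions
    below it, so that the function itself may fail to be measurable. *)
Lemma ge0_integral_ge (f : T -> \bar R) (A : set T) (c : R) :
  measurable A -> 0 <= c -> (forall w, (0 <= f w)%E) ->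
  (forall w, A w -> (c%:E <= f w)%E) -> (c%:E * P A <= \int[P]_w f w)%E.
Proof.
move=> mA c0 f0 fA; rewrite ge0_integralTE //.
pose h := scale_nnsfun (indic_nnsfun R mA) c0.
have <- : sintegral P h = (c%:E * P A)%E.
  transitivity (\int[P]_w (h w)%:E)%E; first by rewrite integral_nnsfun // patch_setT.
  rewrite (eq_integral (fun w => c%:E * (\1_A w)%:E)%E) => [|w _]; last by rewrite -EFinM.
  rewrite ge0_integralZl_EFin //; last exact/measurable_EFinP/measurable_indic.
  by rewrite integral_indic // setIT.
apply: ereal_sup_ubound; exists h => // w.
rewrite -[h w]/(c * \1_A w) indicE; case: (boolP (w \in A)) => [/set_mem /fA|_] /=.
  by rewrite mulr1.
by rewrite mulr0.
Qed.

Lemma markov_real (f : T -> R) (a b : R) : measurable_fun setT f ->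
  (forall w, 0 <= f w) -> 0 < a -> (\int[P]_w (f w)%:E <= (a * b)%:E)%E ->
  (P [set w | a <= f w]%R <= b%:E)%E.
Proof.
move=> mf f0 a0 Ef.
have mA : measurable [set w | a <= f w].
  rewrite (_ : [set _ | _] = f @^-1` `[a, +oo[%classic).
    by rewrite -[X in measurable X]setTI; exact: mf.
  by apply/seteqP; split => w /=; rewrite in_itv /= andbT.
rewrite -(@lee_pmul2l _ a%:E) ?lte_fin // -EFinM; apply: le_trans Ef.
apply: ge0_integral_ge => //; exact: ltW.
Qed.

End LowerIntegral.

Section IllConditioned.
Context d (T : measurableType d) (R : realType) (P : probability T R).
Variables (n p : nat) (X : T -> 'M[R]_(n, p)) (Sigma : 'M[R]_p) (c_m c_M : R).
Hypothesis X_iid : iid_gaussian_rows P X Sigma.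
Hypothesis c_m_gt0 : 0 < c_m.
Hypothesis Sigma_ge : forall u, c_m * dot u u <= dot (u *m Sigma) u.
Hypothesis Sigma_le : forall u, dot (u *m Sigma) u <= c_M * dot u u.

Local Notation Q k w := (residual_proj (row_seq (X w)) k).
Local Notation rho k i w := (residual_sqnorm X k i w w).

(** Empty for [n <= k], so that a single countable union collects the events for all
    rows. *)
Definition degenerate k : set T :=
  [set w | exists2 i : 'I_n, i = k :> nat & 0 < \tr (Q k w) /\ rho k i w = 0].

Lemma degenerate_null k : measurable (degenerate k) /\ P (degenerate k) = 0%E.
Proof.
have [kn|nk] := ltnP k n; last first.
  rewrite (_ : degenerate k = set0) ?measure0 //.
  by apply/seteqP; split => // w [i ik]; move: (ltn_ord i); rewrite ik ltnNge nk.
pose i := Ordinal kn.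
have -> : degenerate k = [set w | 0 < \tr (Q k w) /\ rho k i w = 0].
  apply/seteqP; split => w /=; last by exists i.
  by move=> [j jk]; have -> : j = i by exact: val_inj.
split; last exact: (residual_vanish_null X_iid c_m_gt0 Sigma_ge).
exact: (measurable_residual_vanish X_iid).
Qed.

(** Outside the degenerate events, every row decreases the trace by one until it
    reaches zero or the rows are exhausted. *)
Lemma trace_Q w k : (k <= minn n p)%N -> ~ (\bigcup_k degenerate k) w ->
  \tr (Q k w) = (p - k)%:R.
Proof.
move=> + Nw; elim: k => [|k IH] kmin; first by rewrite mxtrace1 subn0.
have [kn kp] : (k < n)%N /\ (k < p)%N by apply/andP; rewrite -leq_min.
rewrite residual_proj_trace IH ?(ltnW kmin) //.
suff -> : row_seq (X w) k *m Q k w != 0 by rewrite subnS -natrB ?subn_gt0 // subn1.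
apply/negP => /eqP r0; apply: Nw; exists k => //; exists (Ordinal kn) => //.
split; first by rewrite IH ?(ltnW kmin) // ltr0n subn_gt0.
by rewrite /residual_sqnorm -row_seqE r0 dot0l.
Qed.

Lemma expected_trace k : (k <= minn n p)%N ->
  (\int[P]_w (6 * c_M * \tr (Q k w))%:E = (6 * c_M * (p - k)%:R)%:E)%E.
Proof.
move=> kmin.
transitivity (\int[P]_w (cst (6 * c_M * (p - k)%:R)%:E w))%E; last first.
  by rewrite integral_cst // -[RHS]mule1 -(probability_setT P).
apply: ae_eq_integral => //.
  by apply/measurable_EFinP; apply: measurable_funM => //; exact: (measurable_trace X_iid).
have N : P.-negligible (\bigcup_k degenerate k).
  apply: negligible_bigcup => l; exists (degenerate l).
  by have [? ?] := degenerate_null l; split.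
apply: negligibleS N => w /=; apply: contra_notP => Nw _.
by rewrite (trace_Q kmin Nw).
Qed.

(** [H], the sum of the squared residuals with respect to the first [m] rows, bounds
    [n * mu], and its expectation is small because the projector has trace [p - m].
    [G], the number of rows whose first entry is less than [r] in absolute value,
    yields [n * L >= r ^+ 2 * (n - G)], and its expectation is at most [n / 8] by the
    choice of [r]. Markov's inequality makes each of the events [delta * n <= H] and
    [n / 2 <= G] of probability at most one quarter. *)
Lemma ill_conditioned_event (r delta : R) (m := (minn n p).-1) :
  (0 < n)%N -> (0 < p)%N -> 0 <= c_M -> 0 <= r -> 0 < delta ->
  2 * r * normal_peak (Num.sqrt c_m) <= 8^-1 ->
  6 * c_M * ((n - m)%:R * (p - m)%:R) <= delta * n%:R * 4^-1 ->
  exists A, [/\ measurable A, (2^-1%:E <= P A)%E & forall w, A w ->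
    [/\ 0 < mu_min (gram (X w)), mu_min (gram (X w)) <= delta &
        r ^+ 2 / 2 <= lambda_max (gram (X w))]].
Proof.
move=> n0 p0 cM0 r0 delta0 r_small delta_large.
have n1 : 0 < n%:R :> R by rewrite ltr0n.
have m_min : (m < minn n p)%N by rewrite prednK // leq_min n0.
pose e : 'rV[R]_p := delta_mx 0 (Ordinal p0).
have ee : dot e e = 1.
  rewrite dotE (bigD1 (Ordinal p0)) //= !mxE !eqxx /= mulr1 big1 ?addr0 // => j jN.
  by rewrite !mxE (negbTE jN) andbF mulr0.
have e0 : e != 0 by rewrite -dotv_eq0 ee oner_eq0.
pose H w : R := \sum_(i < n) if (m <= i)%N then rho m i w else 0.
have H0 w : 0 <= H w.
  by apply: sumr_ge0 => i _; case: ifP => // _; exact: residual_sqnorm_ge0.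
have mHi (i : 'I_n) : measurable_fun setT (fun w => if (m <= i)%N then rho m i w else 0).
  by case: (m <= i)%N => //; exact: (measurable_residual_sqnorm_diag X_iid m i).
have mH : measurable_fun setT H by exact: measurable_sum.
have EH : (\int[P]_w (H w)%:E <= (delta * n%:R * 4^-1)%:E)%E.
  under eq_integral do rewrite -sumEFin.
  rewrite ge0_integral_sum //; last 2 first.
  - by move=> i; apply/measurable_EFinP.
  - by move=> i w _; rewrite lee_fin; case: ifP => // _; exact: residual_sqnorm_ge0.
  apply: (@le_trans _ _ (\sum_(i < n) (if (m <= i)%N then 6 * c_M * (p - m)%:R else 0)%:E)%E).
    apply: lee_sum => i _; case: ifP => mi; last by rewrite integral0.
    rewrite -expected_trace //; last exact: ltnW.
    exact: (residual_second_moment X_iid c_m_gt0 Sigma_ge Sigma_le).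
  rewrite sumEFin lee_fin; apply: le_trans delta_large.
  rewrite -big_mkcond /= -(big_mkord (fun i => m <= i)%N (fun=> 6 * c_M * (p - m)%:R)).
  rewrite (_ : \sum_(0 <= i < n | _) _ = \sum_(m <= i < n) (6 * c_M * (p - m)%:R)).
    by rewrite sumr_const_nat -[leLHS]mulr_natr -[leLHS]mulrA [X in _ * X <= _]mulrC.
  by rewrite (big_nat_widenl m 0).
pose B (i : 'I_n) := [set w | `|dot (row i (X w)) e| < r].
have mB i : measurable (B i).
  rewrite (_ : B i = (fun w => dot (row i (X w)) e) @^-1` `]- r, r[%classic).
    by rewrite -[X in measurable X]setTI; apply: (measurable_row_dot X_iid).
  by apply/seteqP; split => w /=; rewrite /B /= in_itv /= ltr_norml.
pose G w : R := \sum_(i < n) \1_(B i) w.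
have G0 w : 0 <= G w by apply: sumr_ge0 => i _.
have mG : measurable_fun setT G.
  by apply: measurable_sum => i; exact: measurable_indic.
have EG : (\int[P]_w (G w)%:E <= (n%:R / 2 * 4^-1)%:E)%E.
  under eq_integral do rewrite -sumEFin.
  rewrite ge0_integral_sum //; last first.
    by move=> i; apply/measurable_EFinP; exact: measurable_indic.
  apply: (@le_trans _ _ (\sum_(i < n) (8^-1 : R)%:E)%E).
    apply: lee_sum => i _; rewrite integral_indic // setIT.
    apply: le_trans (row_dot_small X_iid c_m_gt0 Sigma_ge i e0 r0) _.
    by rewrite ee mulr1 lee_fin.
  by rewrite sumEFin lee_fin sumr_const card_ord -mulr_natl; lra.
pose bad := [set w | delta * n%:R <= H w] `|` [set w | n%:R / 2 <= G w] `|`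
  \bigcup_k degenerate k.
have mge (f : T -> R) a : measurable_fun setT f -> measurable [set w | a <= f w].
  move=> mf; rewrite (_ : [set _ | _] = f @^-1` `[a, +oo[%classic).
    by rewrite -[X in measurable X]setTI; exact: mf.
  by apply/seteqP; split => w /=; rewrite in_itv /= andbT.
have mdeg : measurable (\bigcup_k degenerate k).
  by apply: bigcup_measurable => k _; have [] := degenerate_null k.
have mbad : measurable bad by do !apply: measurableU => //; exact: mge.
have Pdeg : P (\bigcup_k degenerate k) = 0%E.
  apply: measure_negligible => //; apply: negligible_bigcup => l.
  by exists (degenerate l); have [? ?] := degenerate_null l; split.
have Pbad : (P bad <= 2^-1%:E)%E.
  have -> : (2^-1%:E = 4^-1%:E + 4^-1%:E + 0 :> \bar R)%E.
    by rewrite adde0 -EFinD; congr EFin; lra.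
  apply: le_trans (measureU2 P _ mdeg) _; first by apply: measurableU; exact: mge.
  apply: leeD; last by rewrite -[X in (_ <= X)%E]Pdeg.
  apply: le_trans (measureU2 P (mge _ _ mH) (mge _ _ mG)) _.
  by apply: leeD; apply: markov_real => //; rewrite ?mulr_gt0 ?divr_gt0.
exists (~` bad); split; first exact: measurableC.
  rewrite probability_setC //.
  rewrite leeBrDr ?fin_num_measure //.
  apply: (@le_trans _ _ (2^-1%:E + 2^-1%:E)%E); first by rewrite leeD2l.
  by rewrite -EFinD lee_fin; lra.
move=> w; rewrite /bad !setCU => -[[/= /negP Hw /negP Gw] Nw].
rewrite -ltNge in Hw; rewrite -ltNge in Gw.
have [mn mp] : (m < n)%N /\ (m < p)%N by apply/andP; rewrite -leq_min.
have r_m : row_seq (X w) m *m Q m w != 0.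
  apply/negP => /eqP rm0; apply: (Nw); exists m => //; exists (Ordinal mn) => //.
  split; last by rewrite /residual_sqnorm -row_seqE rm0 dot0l.
  by rewrite (trace_Q (ltnW m_min) Nw) ltr0n subn_gt0.
have X0 : X w != 0.
  apply/eqP => X0; move: r_m; rewrite (row_seqE (X w) (Ordinal mn)) X0.
  by rewrite (_ : row _ 0 = 0) ?mul0mx ?eqxx //; apply/rowP => a; rewrite !mxE.
have [_ [_ _ mu0 _]] := mu_min_spec n0 X0; split => //.
  rewrite -(ler_pM2l n1) [leRHS]mulrC; apply: le_trans (ltW Hw).
  by apply: le_trans (mu_min_residual_bound n0 r_m) _; rewrite big_mkcond.
have := lambda_max_form e (gram_sym (X w)); rewrite ee mulr1 gram_form_sum.
apply: le_trans; rewrite ler_pdivlMl //.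
apply: (@le_trans _ _ (\sum_(i < n) (r ^+ 2 - r ^+ 2 * \1_(B i) w))).
  rewrite sumrB sumr_const card_ord -mulr_sumr -/(G w) -mulr_natl.
  have : r ^+ 2 * G w <= r ^+ 2 * (n%:R / 2) by rewrite ler_wpM2l ?sqr_ge0 // ltW.
  by lra.
apply: ler_sum => i _; rewrite indicE; case: (boolP (w \in B i)) => [_|].
  by rewrite mulr1 subrr sqr_ge0.
rewrite notin_setE /B /= => /negP; rewrite -leNgt => rB.
rewrite mulr0 subr0 -[leRHS]ger0_norm ?sqr_ge0 // normrX.
by rewrite ler_pXn2r ?nnegrE.
Qed.

End IllConditioned.

(** One of the two factors on the left is equal to 1. *)
Lemma subn_minn_pred_mul (R : realDomainType) (n p : nat) (m := (minn n p).-1) :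
  (0 < n)%N -> (0 < p)%N ->
  (n - m)%:R * (p - m)%:R = `|p%:R - n%:R| + 1 :> R.
Proof.
case: n p @m => // n [//|p] /= _ _; rewrite minnSS /=.
have E (a b : nat) : (a <= b)%N -> (b.+1 - a)%:R = `|b.+1%:R - a.+1%:R| + 1 :> R.
  move=> ab; rewrite subSn // -natr1 natrB // ger0_norm ?subr_ge0 ?ler_nat //.
  by rewrite -!natr1; ring.
case: (leqP n p) => np; first by rewrite subSnn mul1r E.
by rewrite subSnn mulr1 E ?(ltnW np) // distrC.
Qed.

Unset Implicit Arguments.
Set Strict Implicit.
Set Printing Implicit Defensive.

Theorem lemma3p3 (R : realType) (d : measure_display) (T : measurableType d)
    (P : probability T R)
    (p : nat -> nat) (p_gt0 : forall n, (0 < n)%N -> (0 < p n)%N)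
    (Sigma : forall n, 'M[R]_(p n))
    (Sigma_sym : forall n, (0 < n)%N -> (Sigma n)^T = Sigma n)
    (c_m c_M : R) (c_m_gt0 : 0 < c_m) (c_m_le_M : c_m <= c_M)
    (Sigma_min : (c_m%:E <= ereal_inf
       [set (lambda_min (Sigma n))%:E | n in [set n | (0 < n)%N]])%E)
    (Sigma_max : (ereal_sup
       [set (lambda_max (Sigma n))%:E | n in [set n | (0 < n)%N]] <= c_M%:E)%E)
    (X : forall n, T -> 'M[R]_(n, p n))
    (X_iid : forall n, (0 < n)%N -> iid_gaussian_rows P (X n) (Sigma n))
    (b : forall n, T -> 'cV[R]_(p n))
    (b_range : forall n w, (0 < n)%N -> column_space (X n w)^T (b n w)) :
  (forall eps : R, 0 < eps -> eps < 1 -> forall n, (0 < n)%N ->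
     {ae P, forall w,
       let L := lambda_max (gram (X n w)) in
       let mu := mu_min (gram (X n w)) in
       (((Num.ceil ((L - mu) / (2 * mu) * ln (1 / eps)))%:~R : R)%:E
          <= wc_complexity (X n w) (b n w) eps)%E})
  /\
  ((fun n => (p n)%:R / n%:R : R) @ \oo --> (1 : R) ->
   forall eps : R, 0 < eps -> eps < 1 ->
     (\int[P]_w wc_complexity (X n w) (b n w) eps)%E @[n --> \oo] --> +oo%E).
Proof.
have lower n w eps : (0 < n)%N -> 0 < eps -> eps < 1 -> _ :=
  fun n0 => @wc_complexity_lower R n (p n) (X n w) (b n w) eps n0 (p_gt0 n n0) (b_range n w n0).
split=> [eps eps0 eps1 n n0|p_n eps eps0 eps1]; first by apply: aeW => w; exact: lower.
have form_ge n u : (0 < n)%N -> c_m * dot u u <= dot (u *m Sigma n) u.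
  move=> n0; apply: le_trans (lambda_min_form u (Sigma_sym n n0)).
  rewrite ler_wpM2r ?dotv_ge0 // -lee_fin (le_trans Sigma_min) //.
  by apply: ereal_inf_lbound; exists n.
have form_le n u : (0 < n)%N -> dot (u *m Sigma n) u <= c_M * dot u u.
  move=> n0; apply: le_trans (lambda_max_form u (Sigma_sym n n0)) _.
  rewrite ler_wpM2r ?dotv_ge0 // -lee_fin (le_trans _ Sigma_max) //.
  by apply: ereal_sup_ubound; exists n.
have cM0 : 0 < c_M by exact: lt_le_trans c_m_le_M.
have peak0 : 0 < normal_peak (Num.sqrt c_m).
  by rewrite normal_peak_gt0 // gt_eqF // sqrtr_gt0.
pose r := (16 * normal_peak (Num.sqrt c_m))^-1.
have r0 : 0 < r by rewrite invr_gt0 mulr_gt0.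
have r_small : 2 * r * normal_peak (Num.sqrt c_m) <= 8^-1.
  rewrite (_ : _ * _ = 8^-1) // /r; field; rewrite gt_eqF //.
have ln0 : 0 < ln (1 / eps) by rewrite ln_gt0 // div1r invf_gt1.
apply/cvgeyPge => M; pose M' := Num.max M 0.
have M'0 : 0 <= M' by rewrite le_max lexx orbT.
(* The lower bound on the complexity is [2 * M'] when [mu = delta] and
   [L = r ^+ 2 / 2]; the factor 2 makes up for the probability one half. *)
pose delta := r ^+ 2 / 2 / (1 + 4 * M' / ln (1 / eps)).
have D0 : 0 < 1 + 4 * M' / ln (1 / eps).
  by rewrite ltr_wpDr // divr_ge0 ?mulr_ge0 // ltW.
have delta0 : 0 < delta by exact: divr_gt0 (divr_gt0 (exprn_gt0 2 r0) _) D0.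
(* the expected residuals are at most [6 * c_M * (n * gap + n * gap)], and this is
   to be [n * delta / 4] *)
pose gap := delta / (48 * c_M).
have gap0 : 0 < gap by rewrite divr_gt0 // mulr_gt0.
have /cvgrPdist_lt /(_ _ gap0) near_ratio := p_n.
near=> n.
have n0 : (0 < n)%N by near: n; exact: nbhs_infty_gt.
have n1 : 0 < n%:R :> R by rewrite ltr0n.
have ratio : `|1 - (p n)%:R / n%:R| < gap by near: n.
have ngap : gap^-1 < n%:R by near: n; exact: nbhs_infty_gtr.
have [] := ill_conditioned_event (X_iid n n0) c_m_gt0 (fun u => form_ge n u n0)
  (fun u => form_le n u n0) n0 (p_gt0 n n0) (ltW cM0) (ltW r0) delta0 r_small.
  rewrite subn_minn_pred_mul ?p_gt0 //.
  have -> : (p n)%:R - n%:R = - (n%:R * (1 - (p n)%:R / n%:R)) :> R.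
    by field; rewrite gt_eqF.
  rewrite normrN normrM gtr0_norm //.
  have : n%:R * `|1 - (p n)%:R / n%:R| <= n%:R * gap by rewrite ler_wpM2l // ltW.
  have : 1 <= n%:R * gap by rewrite -ler_pdivrMr // div1r ltW.
  move=> H1 H2; rewrite -mulrA.
  have -> : delta * n%:R / 4 = 6 * (c_M * (n%:R * gap + n%:R * gap)).
    by rewrite /gap; field; rewrite gt_eqF.
  by rewrite ler_pM2l // ler_pM2l // lerD.
move=> A [mA PA HA].
apply: (@le_trans _ _ (M'%:E)); first by rewrite lee_fin le_max lexx.
apply: (@le_trans _ _ ((2 * M')%:E * P A)%E).
  apply: (@le_trans _ _ ((2 * M')%:E * (2^-1)%:E)%E).
    by rewrite -EFinM lee_fin mulrAC divff ?mul1r.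
  by rewrite lee_wpmul2l // lee_fin mulr_ge0.
apply: ge0_integral_ge => //; first by rewrite mulr_ge0.
  by move=> w; apply: wc_complexity_ge0; exact: p_gt0.
move=> w /HA[]; have := lower n w eps n0 eps0 eps1; cbv zeta.
set L := lambda_max _; set mu := mu_min _ => wc mu0 mu_le L_ge.
apply: le_trans wc; rewrite lee_fin; apply: le_trans (ceil_ge _).
rewrite -ler_pdivrMr // ler_pdivlMr ?mulr_gt0 // lerBrDr.
apply: le_trans L_ge.
have -> : r ^+ 2 / 2 = delta * (1 + 4 * M' / ln (1 / eps)).
  by rewrite /delta mulfVK // gt_eqF.
rewrite (_ : _ + mu = mu * (1 + 4 * M' / ln (1 / eps))); last by ring.
by rewrite ler_pM2r.
Unshelve. all: by end_near.
Qed.
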